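(* Let $\mathcal{P}$ be the set of primes $p$ such that $p \equiv 1 \pmod 6$ and none of $2, 3, 6$ lies in $(\mathbb{Z}_p^* )^3$. Then $\mathcal{P}$ is infinite, and for every $p \in \mathcal{P}$, $\mathrm{OP}(F)$ has a solution (i.e. $K_p$ has a factorisation into $F$) for every 2-regular graph $F$ of order $p$ with girth at least 6.
   Context: $\mathbb{Z}_p^*$ is the multiplicative group of units modulo $p$ and $(\mathbb{Z}_p^* )^3 = \{x^3 : x \in \mathbb{Z}_p^*\}$ is the subgroup of cubes. A factor of a graph is a spanning subgraph; a factorisation is a decomposition of the edge set into edge-disjoint factors; a factorisation into $F$ is one in which every factor is isomorphic to $F$. For a 2-regular graph $F$ of odd order $n$, $\mathrm{OP}(F)$ asks for a factorisation of $K_n$ into $F$. *)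

(* Defs.v *)
From HB Require Import structures.
From mathcomp Require Import all_boot all_order all_algebra all_fingroup.
From mathcomp Require Import classical_sets cardinality.
Set Implicit Arguments.
Unset Strict Implicit.
Unset Printing Implicit Defensive.

(* For p prime, 'F_p is the ring of integers modulo p and {unit 'F_p} is its
   group of units, whose power operation is the group one. *)
Definition unit_cubes (p : nat) : {set 'F_p} :=
  [set val (x ^+ 3)%g | x : {unit 'F_p}].

Definition noncube_primes : set nat := fun p =>
  [/\ prime p,
      p = 1 %[mod 6],
      (2%:R : 'F_p)%R \notin unit_cubes p,
      (3%:R : 'F_p)%R \notin unit_cubes p
    & (6%:R : 'F_p)%R \notin unit_cubes p].

Record sgraph (V : finType) := SGraph {
  adj :> rel V;
  adj_sym : symmetric adj;
  adj_irr : irreflexive adj }.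

Definition is_regular (V : finType) (k : nat) (G : sgraph V) : Prop :=
  forall x : V, #|[set y | G x y]| = k.

(* The closing edge from the last vertex back to the first is part of
   [ucycle]; the size condition excludes degenerate closed walks of length 2. *)
Definition is_graph_cycle (V : finType) (G : sgraph V) (c : seq V) : Prop :=
  2 < size c /\ ucycle G c.

(* The girth is the least length of a cycle (infinite if there is none). *)
Definition girth_at_least (V : finType) (g : nat) (G : sgraph V) : Prop :=
  forall c : seq V, is_graph_cycle G c -> g <= size c.

Definition isomorphic (V W : finType) (G : sgraph V) (H : sgraph W) : Prop :=
  exists f : V -> W, bijective f /\ forall x y, H (f x) (f y) = G x y.

Lemma neq_sym (V : finType) : symmetric (fun x y : V => x != y).
Proof. by move=> x y; rewrite eq_sym. Qed.

Lemma neq_irr (V : finType) : irreflexive (fun x y : V => x != y).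
Proof. by move=> x; rewrite eqxx. Qed.

Definition complete_graph (n : nat) : sgraph 'I_n :=
  SGraph (@neq_sym 'I_n) (@neq_irr 'I_n).

(* Spanning is built in: both graphs have vertex set V. *)
Definition is_factor (V : finType) (H G : sgraph V) : Prop := subrel H G.

Definition is_factorisation (V : finType) (G : sgraph V)
    (k : nat) (Fs : 'I_k -> sgraph V) : Prop :=
  (forall i, is_factor (Fs i) G) /\
  (forall x y, G x y -> exists! i, Fs i x y).

Definition has_factorisation_into (V W : finType)
    (G : sgraph V) (F : sgraph W) : Prop :=
  exists (k : nat) (Fs : 'I_k -> sgraph V),
    is_factorisation G Fs /\ forall i, isomorphic (Fs i) F.

(* Solvability of the Oberwolfach problem OP(F). *)
Definition OP_solvable (W : finType) (F : sgraph W) : Prop :=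
  has_factorisation_into (complete_graph #|W|) F.

(* Main.v *)
Require Import Defs.
From mathcomp Require Import all_boot all_order all_algebra all_fingroup.
From mathcomp Require Import classical_sets cardinality.
From mathcomp Require Import seq path fintype finset finfield zify ring.
Set Implicit Arguments.
Unset Strict Implicit.
Unset Printing Implicit Defensive.

(** Existence.  If none of 2, 3, 6 is a cube modulo p then 1, 3, 4 lie in the
    three different cosets of the cubes, so K_p is the edge-disjoint union of
    the multiples of the circulant graph with connection set {1, 3, 4} (up to
    sign) by the cubes modulo sign, and it is enough to decompose this circulant
    graph into three copies of F.  Cut Z_p into consecutive blocks, one for each
    cycle of F (or for an 8-cycle together with another cycle): the edges of a
    block split into one m-cycle of each of three colours, where the vertex sets
    and the edge sets overlap the ends of the block in a fixed pattern, so that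
    blocks can be concatenated cyclically.  The finitely many patterns needed
    come from a computer search.

    Infinitude.  For b prime to 3 let n = 16 b^6 + 3 = (4 b^3)^2 + 3 * 1^2.  A
    prime p dividing n is 1 mod 6, and 3 = - 16 b^6 has the cubic character of 2,
    so p is as wanted unless 2 is a cube modulo p.  In the latter case the
    cubic Jacobi sum shows that p = x^2 + 27 y^2.  If that held for all p
    dividing n then, dividing by x +- 3 y sqrt(-3) repeatedly, 4 b^3 + sqrt(-3)
    would have imaginary part divisible by 3. *)

(** * Blocks of the circulant graph on {1, 3, 4} *)

(** Equality of multisets is tested by counting with an arbitrary predicate; once the counts are
    opaque naturals, linear arithmetic suffices. *)
Ltac generalize_counts :=
  repeat match goal with |- context [count ?a ?s] => move: (count a s) => ? end; lia.

Definition shift (w : nat) : seq nat -> seq nat := map (addn w).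

(** [S] is the part of a window of width [w] used from the left, [S'] the overhang past its right
    end in coordinates of the next window. [X] fills exactly what remains, each element once. *)
Definition covers (w : nat) (S S' X : seq nat) : bool :=
  perm_eq (X ++ S) (iota 0 w ++ shift w S').

Lemma shift_shift w w' s : shift w (shift w' s) = shift (w + w') s.
Proof. by rewrite /shift -map_comp; apply: eq_map => x /=; rewrite addnA. Qed.

(** The overhang [S'] of the first window is what the second one finds already used, so the two
    cancel. *)
Lemma covers_cat w w' S S' S'' X Y :
  covers w S S' X -> covers w' S' S'' Y ->
  covers (w + w') S S'' (X ++ shift w Y).
Proof.
rewrite /covers => hX /(perm_map (addn w)) hY.
rewrite iotaD -catA -shift_shift -[0 + w]addnC iotaDl.
apply/permP => a; move/permP/(_ a): hX; move/permP/(_ a): hY.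
rewrite /shift !map_cat !count_cat; generalize_counts.
Qed.

Lemma perm_covers w S S' X Y : perm_eq X Y -> covers w S S' X = covers w S S' Y.
Proof. by move=> h; rewrite /covers; apply: permPl; rewrite perm_cat2r. Qed.

Lemma size_covers w S S' X :
  covers w S S' X -> size S = size S' -> size X = w.
Proof.
by move/perm_size => + eqS; rewrite !size_cat size_iota size_map eqS; exact: addIn.
Qed.

(** With equal patterns at both ends, the overhang wraps around onto the initial gap modulo [n]. *)
Lemma covers_mod n S X :
  covers n S S X -> perm_eq [seq x %% n | x <- X] (iota 0 n).
Proof.
move/(perm_map (modn^~ n)); rewrite !map_cat.
have -> : [seq x %% n | x <- iota 0 n] = iota 0 n.
  by apply: map_id_in => x; rewrite mem_iota => ?; rewrite modn_small.
have -> : [seq x %% n | x <- shift n S] = [seq x %% n | x <- S].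
  by rewrite -map_comp; apply: eq_map => x /=; rewrite modnDl.
by rewrite perm_cat2r.
Qed.

Definition dist (e : nat * nat) : nat := (e.1 - e.2) + (e.2 - e.1).
Definition low (e : nat * nat) : nat := minn e.1 e.2.
Definition diffs : seq nat := [:: 1; 3; 4].
(** An edge is determined by its length and its lower end, so edge-disjointness becomes, for each
    length [d], a covering of integers. *)
Definition lows (d : nat) (es : seq (nat * nat)) : seq nat :=
  [seq low e | e <- es & dist e == d].
Definition short (es : seq (nat * nat)) : bool :=
  all (fun e => dist e \in diffs) es.

Definition shift_edge (w : nat) (e : nat * nat) := (w + e.1, w + e.2).

Lemma dist_shift w e : dist (shift_edge w e) = dist e.
Proof. by rewrite /dist /=; lia. Qed.

Lemma low_shift w e : low (shift_edge w e) = w + low e.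
Proof. by rewrite /low /=; lia. Qed.

Lemma lows_shift d w es : lows d (map (shift_edge w) es) = shift w (lows d es).
Proof.
rewrite /lows /shift filter_map -!map_comp.
under eq_filter do rewrite /= dist_shift.
by apply: eq_map => e /=; rewrite low_shift.
Qed.

Lemma lows_cat d es es' : lows d (es ++ es') = lows d es ++ lows d es'.
Proof. by rewrite /lows filter_cat map_cat. Qed.

Lemma short_shift w es : short (map (shift_edge w) es) = short es.
Proof. by rewrite /short all_map; apply: eq_all => e /=; rewrite dist_shift. Qed.

(** * Edges of paths and of families of cycles *)

Definition path_edges (T : Type) (x : T) (s : seq T) : seq (T * T) :=
  zip (x :: s) s.
Definition cycle_edges (T : Type) (c : seq T) : seq (T * T) := zip c (rot 1 c).
Definition cycles_edges (T : Type) (cs : seq (seq T)) : seq (T * T) :=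
  flatten (map (@cycle_edges T) cs).

Lemma path_edges_cat (T : Type) (x : T) s s' :
  path_edges x (s ++ s') = path_edges x s ++ path_edges (last x s) s'.
Proof. by elim: s x => //= y s IH x; congr cons; apply: IH. Qed.

Lemma path_edges_map (T U : Type) (f : T -> U) x s :
  path_edges (f x) (map f s) = [seq (f e.1, f e.2) | e <- path_edges x s].
Proof. by elim: s x => //= y s IH x; congr cons; apply: IH. Qed.

Lemma cycle_edges_cons (T : Type) (x : T) s :
  cycle_edges (x :: s) = path_edges x (rcons s x).
Proof.
rewrite /cycle_edges /rot /= drop0 take0 cats1 /path_edges.
elim: s {1 3}x => //= y s IH z; congr cons; exact: IH.
Qed.

Lemma cycles_edges_map (T U : Type) (f : T -> U) cs :
  cycles_edges (map (map f) cs) = [seq (f e.1, f e.2) | e <- cycles_edges cs].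
Proof.
rewrite /cycles_edges map_flatten -!map_comp; congr flatten; apply: eq_map => c.
rewrite /= /cycle_edges -map_rot.
by elim: c (rot 1 c) => [|x c IH] [|y d] //=; rewrite IH.
Qed.

Lemma cycles_edges_shift w cs :
  cycles_edges (map (shift w) cs) = map (shift_edge w) (cycles_edges cs).
Proof. exact: cycles_edges_map. Qed.

Lemma cycles_edges_cat (T : Type) (cs cs' : seq (seq T)) :
  cycles_edges (cs ++ cs') = cycles_edges cs ++ cycles_edges cs'.
Proof. by rewrite /cycles_edges map_cat flatten_cat. Qed.

Definition colours : seq nat := [:: 0; 1; 2].

Definition all_edges (E : nat -> seq (nat * nat)) : seq (nat * nat) :=
  flatten (map E colours).

Lemma perm_all_edges_cat E E' :
  perm_eq (all_edges (fun j => E j ++ E' j)) (all_edges E ++ all_edges E').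
Proof.
by apply/permP => a; rewrite /all_edges /= !cats0 !count_cat; generalize_counts.
Qed.

Lemma all_edges_shift w E :
  all_edges (fun j => map (shift_edge w) (E j)) = map (shift_edge w) (all_edges E).
Proof. by rewrite /all_edges /= !map_cat. Qed.

Lemma lows_perm d es es' : perm_eq es es' -> perm_eq (lows d es) (lows d es').
Proof. by move=> h; apply/perm_map/perm_filter. Qed.

(* At a cut before vertex 0, colour j has already used the vertices in
   [sigma j], and the only edge {i, i + d} with i >= 0 already used is
   {0, 3}. *)
Definition sigma (j : nat) : seq nat := nth [::] [:: [::]; [:: 0; 1; 2]; [:: 0; 3]] j.
Definition cut_edges (d : nat) : seq nat := if d == 3 then [:: 0] else [::].

Definition covers_edges w (E : nat -> seq (nat * nat)) : bool :=
  all (fun d => covers w (cut_edges d) (cut_edges d) (lows d (all_edges E))) diffs.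

Lemma covers_edges_cat w w' E E' :
  covers_edges w E -> covers_edges w' E' ->
  covers_edges (w + w') (fun j => E j ++ map (shift_edge w) (E' j)).
Proof.
move=> /allP hE /allP hE'; apply/allP => d hd.
rewrite (perm_covers _ _ _ (lows_perm d (perm_all_edges_cat _ _))).
rewrite all_edges_shift lows_cat lows_shift.
by apply: covers_cat; [apply: hE | apply: hE'].
Qed.

Lemma perm_covers_edges w E E' :
  {in colours, forall j, perm_eq (E j) (E' j)} ->
  covers_edges w E = covers_edges w E'.
Proof.
move=> h; apply: eq_all => d; apply/perm_covers/lows_perm.
rewrite /all_edges /=; do 3![apply: perm_cat; first by apply: h].
by [].
Qed.

(** All three colours list their cycles with the same lengths in the same order, so that they can be
    copies of one graph. Vertices are covered in each colour separately, edges by the three colours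
    together. *)
Definition is_block (ms : seq nat) (c : nat -> seq (seq nat)) : bool :=
  all (fun j => [&& shape (c j) == ms,
                    covers (sumn ms) (sigma j) (sigma j) (flatten (c j))
                  & short (cycles_edges (c j))]) colours
  && covers_edges (sumn ms) (fun j => cycles_edges (c j)).

Lemma is_block_nil : is_block [::] (fun=> [::]).
Proof. by []. Qed.

Lemma is_block_cat ms ms' c c' :
  is_block ms c -> is_block ms' c' ->
  is_block (ms ++ ms') (fun j => c j ++ map (shift (sumn ms)) (c' j)).
Proof.
case/andP=> /allP h1 h2 /andP[/allP h1' h2']; apply/andP; split; last first.
  rewrite sumn_cat (@perm_covers_edges _ _ (fun j => cycles_edges (c j) ++
    map (shift_edge (sumn ms)) (cycles_edges (c' j)))); first exact: covers_edges_cat.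
  by move=> j _; rewrite cycles_edges_cat cycles_edges_shift.
apply/allP => j hj; have /and3P[/eqP s1 c1 e1] := h1 j hj.
have /and3P[/eqP s2 c2 e2] := h1' j hj.
rewrite cycles_edges_cat cycles_edges_shift /short all_cat.
rewrite -!/(short _) short_shift e1 e2 !andbT flatten_cat -[map (shift _) _]/(map (map _) _).
rewrite -map_flatten sumn_cat (covers_cat c1 c2) andbT /shape map_cat -!/(shape _) s1.
rewrite -s2 /shape -map_comp (eq_map (g := size)) ?eqxx // => s /=.
by rewrite size_map.
Qed.

(* Cycles longer than 11 are a left cap, some copies of a tile of width 3 and
   a right cap.  At the cut between two of these parts, colour j has used the
   vertices [tau j], and its unfinished cycle is a path from [tail_end j] to
   [head_end j]. *)
Definition tau (j : nat) : seq nat :=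
  nth [::] [:: [:: 1; 2]; [:: 0; 2; 3]; [:: 0; 1; 3]] j.
Definition head_end (j : nat) : nat := nth 0 [:: 1; 2; 1] j.
Definition tail_end (j : nat) : nat := nth 0 [:: 2; 3; 3] j.

(** The two end vertices belong to the part on the left; [r j] lists only the new vertices between
    them. *)
Definition right_edges (r : nat -> seq nat) (j : nat) :=
  path_edges (head_end j) (rcons (r j) (tail_end j)).

Definition is_right_part (w : nat) (r : nat -> seq nat) : bool :=
  all (fun j => covers w (tau j) (sigma j) (r j) && short (right_edges r j)) colours
  && covers_edges w (right_edges r).

Definition left_edges (c : nat -> seq (seq nat)) (l : nat -> seq nat) w j :=
  cycles_edges (c j) ++ path_edges (w + tail_end j) (l j).

Definition is_left_part (ms : seq nat) (w : nat) (c : nat -> seq (seq nat))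
    (l : nat -> seq nat) : bool :=
  all (fun j => [&& shape (c j) == ms, last 0 (l j) == w + head_end j,
                    0 < size (l j),
                    covers w (sigma j) (tau j)
                      (flatten (c j) ++ (w + tail_end j) :: l j)
                  & short (left_edges c l w j)]) colours
  && covers_edges w (left_edges c l w).

(** The left part leads from the tail end to the head end, and the right part returns from the head
    end to the tail end, closing one cycle of length [m] in each colour. *)
Lemma is_block_left_right ms w w' c l r m :
  is_left_part ms w c l -> is_right_part w' r -> w + w' = sumn ms + m ->
  is_block (rcons ms m)
    (fun j => rcons (c j) ((w + tail_end j) :: l j ++ shift w (r j))).
Proof.
case/andP=> /allP h1 h2 /andP[/allP h1' h2'] hm.
have sumE : sumn (rcons ms m) = w + w' by rewrite sumn_rcons hm.
have edgesE j : j \in colours -> perm_eq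
    (cycles_edges (rcons (c j) ((w + tail_end j) :: l j ++ shift w (r j))))
    (left_edges c l w j ++ map (shift_edge w) (right_edges r j)).
  move=> hj; have /and5P[_ /eqP hl0 hs _ _] := h1 j hj.
  have hl : last (w + tail_end j) (l j) = w + head_end j.
    (* Since [l j] is not empty, its last element does not depend on the default value. *)
    by rewrite -hl0; case: (l j) hs.
  rewrite -cats1 cycles_edges_cat /left_edges -catA perm_cat2l.
  rewrite /cycles_edges /= cats0 cycle_edges_cons -cats1 -catA path_edges_cat.
  by rewrite hl perm_cat2l cats1 -map_rcons path_edges_map.
apply/andP; split; last first.
  by rewrite sumE (perm_covers_edges _ edgesE) covers_edges_cat.
apply/allP => j hj; have /and5P[/eqP hs _ _ hc hsh] := h1 j hj.
have /andP[hc' hsh'] := h1' j hj.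
have cov : covers (sumn (rcons ms m)) (sigma j) (sigma j)
    (flatten (rcons (c j) ((w + tail_end j) :: l j ++ shift w (r j)))).
  rewrite sumE flatten_rcons -cat_cons catA; exact: covers_cat hc hc'.
rewrite cov /short (perm_all _ (edgesE j hj)) all_cat -!/(short _) hsh short_shift hsh' !andbT.
have := size_covers cov erefl; rewrite size_flatten /shape map_rcons -/(shape _) hs.
by rewrite !sumn_rcons => /addnI ->.
Qed.

(** The two strands of the tile of width 3: [mid_up] leads from the head end at one cut to the head
    end at the next, and [mid_down] comes back from tail end to tail end. *)
Definition mid_up (j : nat) := nth [::] [:: [:: 0; 4]; [:: 1; 5]; [:: 4]] j.
Definition mid_down (j : nat) := nth [::] [:: [:: 5]; [:: 6]; [:: 6; 2]] j.
Definition extend (r : nat -> seq nat) (j : nat) : seq nat :=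
  mid_up j ++ shift 3 (r j) ++ mid_down j.

Definition mid_edges (j : nat) :=
  path_edges (head_end j) (mid_up j) ++
  path_edges (3 + tail_end j) (rcons (behead (mid_down j)) (tail_end j)).

Lemma is_right_part_extend w r :
  is_right_part w r -> is_right_part (3 + w) (extend r).
Proof.
case/andP=> /allP h1 h2.
have edgesE j : j \in colours -> perm_eq (right_edges (extend r) j)
    (mid_edges j ++ map (shift_edge 3) (right_edges r j)).
  move=> hj; rewrite /right_edges /extend -cats1 -!catA path_edges_cat.
  have -> : last (head_end j) (mid_up j) = 3 + head_end j.
    by move: hj; rewrite !inE => /or3P[] /eqP ->.
  have -> : mid_down j = (3 + tail_end j) :: behead (mid_down j).
    by move: hj; rewrite !inE => /or3P[] /eqP ->.
  rewrite cat_cons -cat_rcons -map_rcons path_edges_cat path_edges_map last_map.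
  by rewrite last_rcons cats1 /mid_edges perm_cat2l perm_catC.
apply/andP; split; last first.
  by rewrite (perm_covers_edges _ edgesE) covers_edges_cat.
apply/allP => j hj; have /andP[hc hsh] := h1 j hj; apply/andP; split.
  rewrite (perm_covers _ _ _ (Y := (mid_up j ++ mid_down j) ++ shift 3 (r j))).
    apply: covers_cat hc.
    by move: hj; rewrite !inE => /or3P[] /eqP ->.
  by rewrite /extend -catA perm_cat2l perm_catC.
rewrite /short (perm_all _ (edgesE j hj)) all_cat -!/(short _) short_shift hsh andbT.
by move: hj; rewrite !inE => /or3P[] /eqP ->.
Qed.

(** Right parts of widths 7, 8 and 9, one for each residue modulo the tile width 3. *)
Definition right_cap (w : nat) : nat -> seq nat := nth [::]
  (nth [::]
   [:: [:: [:: 0; 4; 3; 6; 5]; [:: 1; 4; 8; 5; 9; 6; 7]; [:: 5; 4; 7; 10; 6; 2]];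
       [:: [:: 0; 4; 7; 3; 6; 5]; [:: 1; 5; 9; 6; 10; 7; 8; 4];
           [:: 4; 5; 8; 11; 7; 6; 2]];
       [:: [:: 0; 4; 8; 5; 6; 7; 3]; [:: 1; 4; 5; 9; 8; 11; 7; 10; 6];
           [:: 5; 2; 6; 9; 12; 8; 7; 4]]] w).

Lemma right_part_exists w : 7 <= w -> exists r, is_right_part w r.
Proof.
move=> hw; have hk : is_right_part (7 + (w - 7) %% 3) (right_cap ((w - 7) %% 3)).
  have : (w - 7) %% 3 < 3 by rewrite ltn_mod.
  by case: (_ %% 3) => [|[|[|]]].
have -> : w = ((w - 7) %/ 3) * 3 + (7 + (w - 7) %% 3) by lia.
elim: (_ %/ 3) => [|q [r hr]]; first by exists (right_cap ((w - 7) %% 3)).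
by exists (extend r); rewrite mulSn -addnA; apply: is_right_part_extend.
Qed.

Definition left_cap : nat -> seq nat :=
  nth [::] [:: [:: 4; 0; 1; 2; 3; 6]; [:: 5; 4; 3; 7]; [:: 4; 1; 5; 2; 6]].

(** Together with [left_octagon] this is a left part of width 13 = 8 + 5, holding a whole 8-cycle
    besides the open path. *)
Definition left_cap8 : nat -> seq nat :=
  nth [::] [:: [:: 12; 9; 10; 7; 11; 14]; [:: 12; 8; 11; 15]; [:: 13; 12; 11; 10; 14]].
Definition left_octagon (j : nat) : seq (seq nat) :=
  nth [::] [:: [:: [:: 0; 1; 2; 3; 6; 5; 8; 4]]; [:: [:: 3; 4; 5; 9; 13; 10; 6; 7]];
               [:: [:: 1; 4; 7; 8; 9; 6; 2; 5]]] j.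

(** * Blocks for prescribed cycle lengths *)

Definition block (ms : seq nat) : Prop := exists c, is_block ms c.

Lemma block_single m : 6 <= m -> m != 8 -> block [:: m].
Proof.
move=> h6 h8; case: (leqP 12 m) => [h12|].
  (* The left cap has width 5 and the smallest right part width 7, hence the threshold 12. *)
  have [r hr] := right_part_exists (w := m - 5) ltac:(lia).
  have hl : is_left_part [::] 5 (fun=> [::]) left_cap by [].
  by eexists; apply: (is_block_left_right (ms := [::]) hl hr); rewrite /=; lia.
pose B c m := is_block [:: m] (fun j => [:: nth [::] c j]).
have ex c : B c m -> block [:: m] by move=> hB; eexists; exact: hB.
move=> h12; have : m \in [:: 6; 7; 9; 10; 11] by rewrite !inE; lia.
rewrite !inE => /or4P[| | |/orP[]] /eqP hm; move: ex; rewrite hm => ex.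
- by apply: (ex [:: [:: 0; 1; 5; 2; 3; 4]; [:: 3; 6; 5; 8; 4; 7];
    [:: 1; 4; 5; 9; 6; 2]]).
- by apply: (ex [:: [:: 0; 1; 2; 3; 6; 5; 4]; [:: 3; 4; 8; 5; 9; 6; 7];
    [:: 1; 4; 7; 10; 6; 2; 5]]).
- by apply: (ex [:: [:: 0; 1; 2; 3; 7; 6; 5; 8; 4]; [:: 3; 6; 10; 7; 11; 8; 9; 5; 4];
    [:: 1; 4; 7; 8; 12; 9; 6; 2; 5]]).
- by apply: (ex [:: [:: 0; 1; 2; 3; 6; 9; 5; 8; 7; 4];
    [:: 3; 4; 5; 6; 10; 9; 12; 8; 11; 7]; [:: 1; 4; 8; 9; 13; 10; 7; 6; 2; 5]]).
- by apply: (ex [:: [:: 0; 1; 2; 3; 7; 10; 6; 5; 9; 8; 4];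
    [:: 3; 6; 7; 11; 10; 13; 9; 12; 8; 5; 4];
    [:: 1; 4; 7; 8; 11; 14; 10; 9; 6; 2; 5]]).
Qed.

Lemma block_88 : block [:: 8; 8].
Proof.
by exists (nth [::]
  [:: [:: [:: 0; 1; 5; 6; 2; 3; 7; 4]; [:: 8; 9; 10; 13; 14; 11; 15; 12]];
      [:: [:: 3; 6; 10; 7; 11; 8; 5; 4]; [:: 9; 12; 16; 15; 18; 14; 17; 13]];
      [:: [:: 1; 4; 8; 7; 6; 9; 5; 2]; [:: 10; 11; 12; 13; 16; 19; 15; 14]]]).
Qed.

Lemma block_8_odd m : 6 <= m -> odd m -> block [:: 8; m].
Proof.
move=> h6 hodd; case: (leqP 12 m) => [h12|].
  have [r hr] := right_part_exists (w := m - 5) ltac:(lia).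
  have hl : is_left_part [:: 8] 13 left_octagon left_cap8 by [].
  by eexists; apply: (is_block_left_right (ms := [:: 8]) hl hr); rewrite /=; lia.
have ex c : is_block [:: 8; m] (nth [::] c) -> block [:: 8; m].
  by move=> hB; eexists; exact: hB.
move=> h12; have : m \in [:: 7; 9; 11] by rewrite !inE; lia.
rewrite !inE => /or3P[] /eqP hm; move: ex; rewrite hm => ex.
- by apply: (ex
   [:: [:: [:: 7; 10; 14; 13; 9; 12; 8; 11]; [:: 0; 1; 2; 3; 6; 5; 4]];
       [:: [:: 3; 4; 8; 5; 9; 10; 6; 7]; [:: 11; 12; 16; 13; 17; 14; 15]];
       [:: [:: 1; 4; 7; 8; 9; 6; 2; 5]; [:: 10; 13; 12; 15; 18; 14; 11]]]).
- by apply: (ex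
   [:: [:: [:: 5; 8; 12; 16; 15; 14; 13; 9]; [:: 0; 1; 2; 3; 6; 10; 11; 7; 4]];
       [:: [:: 10; 13; 17; 16; 19; 15; 18; 14]; [:: 3; 4; 5; 6; 9; 12; 11; 8; 7]];
       [:: [:: 11; 14; 17; 20; 16; 13; 12; 15]; [:: 1; 4; 8; 9; 10; 7; 6; 2; 5]]]).
- by apply: (ex
   [:: [:: [:: 11; 14; 18; 15; 16; 17; 13; 12]; [:: 0; 1; 2; 3; 6; 9; 10; 7; 8; 5; 4]];
       [:: [:: 3; 4; 8; 12; 9; 5; 6; 7]; [:: 10; 11; 15; 19; 18; 21; 17; 20; 16; 13; 14]];
       [:: [:: 12; 15; 14; 17; 18; 22; 19; 16]; [:: 1; 4; 7; 11; 8; 9; 13; 10; 6; 2; 5]]]).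
Qed.

Lemma block_cat ms ms' : block ms -> block ms' -> block (ms ++ ms').
Proof. by move=> [c hc] [c' hc']; eexists; apply: is_block_cat hc hc'. Qed.

Lemma block_even_nseq8 k : ~~ odd k -> block (nseq k 8).
Proof.
move=> hk; rewrite -(even_halfK hk); elim: (k./2) => [|n IH].
  by eexists; exact: is_block_nil.
by rewrite doubleS; exact: (block_cat block_88 IH).
Qed.

Lemma block_not8 ms : all (leq 6) ms -> 8 \notin ms -> block ms.
Proof.
elim: ms => [|m ms IH] /=; first by move=> _ _; eexists; exact: is_block_nil.
case/andP=> hm hms; rewrite inE negb_or eq_sym => /andP[h8 h8s].
exact: (block_cat (block_single hm h8) (IH hms h8s)).
Qed.

(** Cycles of length 8 are used up in pairs. If their number is odd, one of them is joined to a
    cycle of odd length, which exists because the total is odd. *)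
Lemma block_perm_exists ms :
  all (leq 6) ms -> odd (sumn ms) -> exists2 ms', perm_eq ms ms' & block ms'.
Proof.
move=> h6 hodd.
have split8 s : perm_eq s (nseq (count_mem 8 s) 8 ++ filter (predC1 8) s).
  rewrite perm_sym; apply: perm_trans _ (permEl (perm_filterC (pred1 8) s)).
  by have /all_pred1P -> := filter_all (pred1 8) s; rewrite size_filter.
have not8 s : all (leq 6) s -> block (filter (predC1 8) s).
  move=> hs; apply: block_not8; last by rewrite mem_filter.
  by rewrite all_filter; apply: sub_all hs => x /= ->; rewrite implybT.
case hk: (odd (count_mem 8 ms)); last first.
  exists (nseq (count_mem 8 ms) 8 ++ filter (predC1 8) ms) => //.
  by apply: block_cat (not8 _ h6); apply: block_even_nseq8; rewrite hk.
have /hasP[m hm modd] : has odd ms.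
  apply: contraLR hodd => /hasPn hev; elim: ms hev {h6 hk} => //= x s IH hev.
  rewrite oddD negb_add (negbTE (hev x _)) ?mem_head //.
  by rewrite eq_sym eqbF_neg IH // => y hy; apply: hev; rewrite inE hy orbT.
have h8 : 8 \in rem m ms.
  rewrite -has_pred1 has_count count_rem hm /=.
  have -> : (m == 8) = false by apply/negP => /eqP hm8; rewrite hm8 in modd.
  by rewrite subn0; case: (count_mem 8 ms) hk.
set s := rem 8 (rem m ms).
have hp : perm_eq ms ([:: 8; m] ++ s).
  rewrite perm_sym (perm_catCA [:: 8] [:: m] s) perm_sym.
  by rewrite (permPl (perm_to_rem hm)) perm_cons perm_to_rem.
have hs : all (leq 6) s.
  by apply/allP => x /mem_rem/mem_rem; apply/allP.
exists ([:: 8; m] ++ nseq (count_mem 8 s) 8 ++ filter (predC1 8) s).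
  by rewrite (permPl hp) perm_cat2l.
apply: block_cat; first by apply: block_8_odd => //; apply: (allP h6).
apply: block_cat (not8 _ hs); apply: block_even_nseq8.
move: hk; move/permP/(_ (pred1 8)): hp => -> /=.
have -> : (m == 8) = false by apply/negP => /eqP hm8; rewrite hm8 in modd.
by rewrite oddD /=; case: odd.
Qed.

(** * Two-regular graphs *)

Section TwoRegular.

Variables (V : finType) (F : sgraph V).
Hypothesis F2 : is_regular 2 F.

Lemma two_regular_neighbours x y z t :
  F x y -> F x z -> F x t -> y != z -> (t == y) || (t == z).
Proof.
move=> xy xz xt yz; have e : [set y; z] = [set t | F x t].
  apply/eqP; rewrite eqEcard F2 cards2 yz andbT.
  by apply/subsetP => u; rewrite !inE => /orP[] /eqP ->.
by have : t \in [set y; z]; [rewrite e inE | rewrite !inE].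
Qed.

Lemma two_regular_other x y : F x y -> exists2 z, F x z & z != y.
Proof.
move=> xy; have : #|[set z | F x z] :\ y| != 0.
  by have := cardsD1 y [set z | F x z]; rewrite F2 inE xy; case: #|_|.
by rewrite cards_eq0 => /set0Pn[z]; rewrite !inE => /andP[h1 h2]; exists z.
Qed.

(** The path is extended until its new neighbour [z] already lies on it; 2-regularity forces that
    vertex to be the start [x]. *)
Lemma close_path x s y :
  path F x (rcons s y) -> uniq (x :: rcons s y) ->
  exists2 c, is_graph_cycle F c & x \in c.
Proof.
have [n] := ubnP (#|V| - size s); elim: n s y => // n IH s y hn hpath huniq.
have hyl : F y (last x s).
  by move: hpath; rewrite rcons_path adj_sym => /andP[].
have [z yz hz] := two_regular_other hyl.
have [zin|zout] := boolP (z \in x :: rcons s y); last first.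
  have hu : uniq (x :: rcons (rcons s y) z).
    rewrite -rcons_cons rcons_uniq zout; exact: huniq.
  apply: (IH (rcons s y) z) => //; last by rewrite rcons_path hpath last_rcons.
  have : size (x :: rcons (rcons s y) z) <= #|V| by rewrite -(card_uniqP hu) max_card.
  move: hn; rewrite /= !size_rcons; move: #|V| (size s) => N m; lia.
have zy : z != y by apply: contraTneq yz => ->; rewrite adj_irr.
move: zin; rewrite inE mem_rcons inE (negbTE zy) /= => /orP[/eqP zx|zs].
  exists (x :: rcons s y); last exact: mem_head.
  split.
    rewrite /= size_rcons; case: s hz {IH hn hpath huniq hyl} => //=.
    by rewrite zx eqxx.
  by apply/andP; split=> //=; rewrite rcons_path hpath last_rcons -zx.
(* An interior [z] would have three distinct neighbours: its predecessor, its successor [u] and [y].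
   The successor lies in [s2], which is not empty because [z] is not the predecessor of [y]. *)
case/splitPr: zs hz hpath huniq hyl {IH hn} => s1 s2 hz.
rewrite last_cat /= in hz; rewrite rcons_cat -cat_cons cat_uniq cat_path.
case: s2 hz => [|u s2] hz; first by rewrite eqxx in hz.
move=> /andP[_ +] /and3P[_ /hasPn h +] _ => /= /and3P[hzl hzu _] /and3P[_ hu _].
have zl : F z (last x s1) by rewrite adj_sym.
have zy' : F z y by rewrite adj_sym.
have hlu : last x s1 != u.
  by apply: contraNneq (h u _) => [<-|]; rewrite ?mem_last // !inE eqxx orbT.
have hyl : y != last x s1.
  by apply: contraNneq (h y _) => [->|]; rewrite ?mem_last // !inE mem_rcons inE eqxx !orbT.
have hyu : y != u by apply: contraNneq hu => <-; rewrite mem_rcons mem_head.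
have := two_regular_neighbours zl hzu zy' hlu.
by rewrite (negbTE hyl) (negbTE hyu).
Qed.

Lemma two_regular_cycle x : exists2 c, is_graph_cycle F c & x \in c.
Proof.
have : #|[set y | F x y]| != 0 by rewrite F2.
rewrite cards_eq0 => /set0Pn[y]; rewrite inE => xy.
apply: (@close_path x [::] y); rewrite /= ?xy // inE andbT.
by apply: contraTneq xy => ->; rewrite adj_irr.
Qed.

Lemma graph_cycle_neighbours c x y :
  is_graph_cycle F c -> x \in c -> F x y -> y = next c x \/ x = next c y.
Proof.
case=> hsize /andP[hc hu] xc xy.
have h1 : F x (next c x) by exact: next_cycle.
have h2 : F x (prev c x) by rewrite adj_sym; exact: prev_cycle.
(* Otherwise two steps along the cycle would return to [x], which a length above 2 forbids. *)
have hnp : next c x != prev c x.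
  apply/eqP => e; have : next c (next c x) = x by rewrite e next_prev.
  have [i s hs] := rot_to xc; rewrite -!(next_rot i hu) hs.
  move: hu hsize; rewrite -(rot_uniq i) -(size_rot i) hs.
  case: s {hs} => [|u [|v s]] //= + _; rewrite !inE !negb_or !eqxx.
  by case/and4P=> /and3P[xu xv _] _ _ _; rewrite eq_sym (negbTE xu) => /eqP; rewrite eq_sym (negbTE xv).
have := two_regular_neighbours h1 h2 xy hnp => /orP[/eqP ->|/eqP ->]; first by left.
by right; rewrite next_prev.
Qed.

(** Removing a cycle from a set closed under adjacency leaves such a set, since both neighbours of a
    cycle vertex lie on the cycle. *)
Lemma two_regular_decomposition (A : {set V}) :
  (forall x y, x \in A -> F x y -> y \in A) ->
  exists cs : seq (seq V), [/\ forall c, c \in cs -> is_graph_cycle F c,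
    uniq (flatten cs) & flatten cs =i A].
Proof.
have [n] := ubnP #|A|; elim: n A => // n IH A hn hA.
case: (set_0Vmem A) => [->|[x xA]]; first by exists [::]; split=> // y; rewrite inE.
have [c hc xc] := two_regular_cycle x.
have cyc : cycle F c by case: hc => _ /andP[].
have hcA y : y \in c -> y \in A.
  have [i s hs] := rot_to xc; move: cyc; rewrite -(mem_rot i) -(rot_cycle i) hs /=.
  rewrite rcons_path => /andP[+ _]; rewrite inE => hs' /orP[/eqP -> //|].
  elim: s x xA hs' {xc hs} => //= u s IHs x xA /andP[xu hs].
  have uA := hA _ _ xA xu.
  by rewrite inE => /orP[/eqP -> //|]; apply: IHs hs.
pose A' := A :\: [set y in c].
have [||cs [h1 h2 h3]] := IH A'.
- have : A' \proper A.
    apply/properP; split; first exact: subsetDl.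
    by exists x => //; rewrite !inE xc.
  by move/proper_card; lia.
- move=> y z; rewrite !inE => /andP[yc yA] yz; rewrite (hA y z) // andbT.
  apply: contra yc => zc.
  have zy : F z y by rewrite adj_sym.
  case: (graph_cycle_neighbours hc zc zy) => [->|]; first by rewrite mem_next.
  by move=> zE; move: zc; rewrite zE mem_next.
exists (c :: cs); split.
- by move=> d; rewrite inE => /orP[/eqP -> //|]; apply: h1.
- rewrite /= cat_uniq h2 andbT; case: hc => _ /andP[_ ->] /=.
  by apply/hasPn => y; rewrite h3 !inE => /andP[].
- move=> y; rewrite /= mem_cat h3 !inE.
  by case yc: (y \in c) => //=; rewrite hcA.
Qed.

End TwoRegular.

(** Serves to reorder the cycles of a graph once their lengths have been put in an order that admits
    a block. *)
Lemma perm_map_lift (T U : eqType) (f : T -> U) (s : seq T) (t : seq U) :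
  perm_eq (map f s) t -> exists2 s', perm_eq s s' & map f s' = t.
Proof.
elim: s t => [|x s IH] t /=.
  by rewrite perm_sym => /perm_nilP ->; exists [::].
move=> hp; have ht : f x \in t by rewrite -(perm_mem hp) mem_head.
case/splitPr: ht hp => t1 t2; rewrite perm_sym perm_catC /= perm_cons perm_catC perm_sym.
move=> /IH[s' hs' hmap].
have e : s' = take (size t1) s' ++ drop (size t1) s' by rewrite cat_take_drop.
exists (take (size t1) s' ++ x :: drop (size t1) s').
  by rewrite perm_sym perm_catC /= perm_cons perm_catC -e perm_sym.
by rewrite map_cat /= map_take map_drop hmap take_size_cat // drop_size_cat.
Qed.

Lemma dist_sym a b : dist (a, b) = dist (b, a).
Proof. by rewrite /dist addnC. Qed.

Lemma low_sym a b : low (a, b) = low (b, a).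
Proof. exact: minnC. Qed.

Lemma mem_next_cycle_edges (T : eqType) (c : seq T) x :
  x \in c -> (x, next c x) \in cycle_edges c.
Proof.
move=> xc; have hi : index x c < size c by rewrite index_mem.
have -> : (x, next c x) = nth (x, x) (cycle_edges c) (index x c).
  rewrite nth_zip ?size_rot // nth_index // next_nth xc.
  case: c {xc} hi => // y c hi; rewrite rot1_cons nth_rcons; case: ltngtP => // h.
  - by congr pair; apply: set_nth_default.
  - by move: hi; rewrite ltnS leqNgt h.
  - by rewrite nth_default // h.
by rewrite mem_nth // size_zip size_rot minnn.
Qed.

Lemma uniq_flatten_map (T U : eqType) (L : T -> seq U) (s : seq T) j j' x :
  uniq (flatten (map L s)) -> j \in s -> j' \in s -> x \in L j -> x \in L j' ->
  j = j'.
Proof.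
elim: s => //= i s IH; rewrite cat_uniq => /and3P[_ /hasPn h hu].
have hi k : k \in s -> x \in L k -> x \in L i -> j = j'.
  move=> ks xk xi; have : x \in flatten (map L s).
    by apply/flattenP; exists (L k) => //; apply: map_f.
  by move/h; rewrite xi.
rewrite !inE => /orP[/eqP ji|js] /orP[/eqP j'i|j's] xj xj'.
- by rewrite ji j'i.
- by apply: (hi j') => //; rewrite -ji.
- by apply: (hi j) => //; rewrite -j'i.
- exact: IH.
Qed.

(** * Three edge-disjoint copies of F in the circulant graph *)

Section Colouring.

Variables (V : finType) (F : sgraph V).
Hypothesis F2 : is_regular 2 F.
Hypothesis F6 : girth_at_least 6 F.
Hypothesis oddV : odd #|V|.

(** [g j] places the vertices in colour [j]. Its values are integers that may overhang [#|V|],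
    because length and lower end are read off before reduction modulo [#|V|]. *)
Lemma colour_maps : exists g : nat -> V -> nat,
  [/\ forall j, j \in colours -> injective (fun x => g j x %% #|V|),
      forall j x y, j \in colours -> F x y -> dist (g j x, g j y) \in diffs
    & forall j j' x y x' y', j \in colours -> j' \in colours ->
        F x y -> F x' y' ->
        dist (g j x, g j y) = dist (g j' x', g j' y') ->
        low (g j x, g j y) = low (g j' x', g j' y') %[mod #|V|] -> j = j'].
Proof.
have [//|cs0 [hcyc0 huniq0 hmem0]] := @two_regular_decomposition V F F2 (finset.setTfor V).
have perm0 : perm_eq (flatten cs0) (enum V).
  apply: uniq_perm => //; first exact: enum_uniq.
  by move=> x; rewrite hmem0 mem_enum !inE.
have shape6 : all (leq 6) (shape cs0).
  by apply/allP => _ /mapP[c /hcyc0 hc ->]; exact: F6.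
have sumV : sumn (shape cs0) = #|V|.
  by rewrite -size_flatten (perm_size perm0) -cardE.
have [ms hms [c /andP[/allP hc1 /allP hc2]]] : exists2 ms, perm_eq (shape cs0) ms & block ms.
  by apply: block_perm_exists; rewrite ?sumV.
have [cs hcs hshape] := perm_map_lift hms.
have hcyc d : d \in cs -> is_graph_cycle F d.
  by rewrite -(perm_mem hcs); exact: hcyc0.
have permV : perm_eq (flatten cs) (enum V).
  apply: perm_trans perm0; apply: perm_flatten; by rewrite perm_sym.
have summs : sumn ms = #|V| by rewrite -sumV; apply/esym/perm_sumn.
have huniq : uniq (flatten cs) by rewrite (perm_uniq permV) enum_uniq.
have hmem x : x \in flatten cs by rewrite (perm_mem permV) mem_enum.
(* The i-th vertex along the cycles of F goes to the i-th vertex of colour [j]; both families of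
   cycles have shape [ms]. *)
pose g j x := nth 0 (flatten (c j)) (index x (flatten cs)).
have hg j : j \in colours -> map (map (g j)) cs = c j.
  move=> /hc1/and3P[/eqP hs _ _]; have hsh : shape (map (map (g j)) cs) = shape (c j).
    rewrite hs -hshape /shape -map_comp; apply: eq_map => s /=; exact: size_map.
  apply: eq_from_flatten_shape => //; rewrite -map_flatten.
  have hsz : size (flatten cs) = size (flatten (c j)).
    by rewrite !size_flatten hs -hshape.
  apply: (@eq_from_nth _ 0); first by rewrite size_map.
  move=> i; rewrite size_map => hi.
  case: (flatten cs) hi huniq @g {hsh} => // x0 s hi hu g.
  by rewrite (nth_map x0) // /g index_uniq.
have edgeE x y : F x y ->
    (x, y) \in cycles_edges cs \/ (y, x) \in cycles_edges cs.
  move=> xy; have /flattenP[d hd xd] := hmem x.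
  have hin z : z \in d -> (z, next d z) \in cycles_edges cs.
    move=> zd; apply/flattenP; exists (cycle_edges d); first exact: map_f.
    exact: mem_next_cycle_edges.
  have [yE|xE] := graph_cycle_neighbours F2 (hcyc d hd) xd xy.
    by left; rewrite yE hin.
  by right; rewrite xE hin //; move: xd; rewrite xE mem_next.
have edges_c j : j \in colours ->
    cycles_edges (c j) = [seq (g j e.1, g j e.2) | e <- cycles_edges cs].
  by move=> hj; rewrite -cycles_edges_map hg.
have hshort j x y : j \in colours -> F x y -> dist (g j x, g j y) \in diffs.
  move=> hj xy; have /and3P[_ _ /allP hsh] := hc1 j hj.
  rewrite edges_c // in hsh.
  have [h|h] := edgeE x y xy; last rewrite dist_sym;
    exact: (hsh _ (map_f (fun e => (g j e.1, g j e.2)) h)).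
exists g; split.
(* The block has width [#|V|], so its right cut is its left cut modulo [#|V|] and every residue is
   met once. *)
- move=> j hj; have /and3P[_ /covers_mod + _] := hc1 j hj.
  rewrite -hg // -map_flatten summs -map_comp => /perm_uniq.
  rewrite iota_uniq (perm_uniq (perm_map _ permV)) => /injectiveP h x y; exact: h.
- exact: hshort.
- move=> j j' x y x' y' hj hj' xy xy' hd hl.
  set d := dist (g j x, g j y) in hd.
  have hdd : d \in diffs.
    exact: hshort.
  have := hc2 d hdd => /covers_mod/perm_uniq; rewrite iota_uniq summs.
  (* The three lists [L i] together have no repetition, so a common lower end identifies the
     colour. *)
  pose L i := [seq z %% #|V| | z <- lows d (cycles_edges (c i))].
  rewrite (_ : map _ _ = flatten (map L colours)); last first.
    by rewrite /all_edges /= !cats0 !lows_cat !map_cat.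
  have inL i u v : i \in colours -> F u v -> dist (g i u, g i v) = d ->
      low (g i u, g i v) %% #|V| \in L i.
    move=> hi uv huv; apply: map_f; rewrite edges_c //.
    case: (edgeE u v uv) => h.
      apply/mapP; exists (g i u, g i v) => //; rewrite mem_filter huv eqxx.
      exact: (map_f (fun e => (g i e.1, g i e.2)) h).
    rewrite low_sym; apply/mapP; exists (g i v, g i u) => //.
    rewrite mem_filter dist_sym huv eqxx.
    exact: (map_f (fun e => (g i e.1, g i e.2)) h).
  move/uniq_flatten_map; apply; first exact: hj.
  - exact: hj'.
  - exact: inL hj xy erefl.
  - by rewrite hl; apply: inL.
Qed.

End Colouring.

(** * Packing edge-disjoint copies into a complete graph *)

Section Packing.

Variables (V K : finType) (F : sgraph V) (h : K -> V -> 'I_#|V|).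
Hypothesis h_inj : forall k, injective (h k).
Hypothesis h_disjoint : forall k k' x y x' y', F x y -> F x' y' ->
  h k x = h k' x' -> h k y = h k' y' -> k = k'.

Definition copy_rel (k : K) : rel 'I_#|V| := fun a b =>
  [exists q : V * V, [&& F q.1 q.2, h k q.1 == a & h k q.2 == b]].

Lemma copy_relP k a b :
  reflect (exists x y, [/\ F x y, h k x = a & h k y = b]) (copy_rel k a b).
Proof.
apply: (iffP existsP) => [[[x y] /= /and3P[xy /eqP xa /eqP yb]]|[x [y [xy xa yb]]]].
  by exists x, y.
by exists (x, y); rewrite /= xy xa yb !eqxx.
Qed.

Lemma copy_sym k : symmetric (copy_rel k).
Proof.
by move=> a b; apply/copy_relP/copy_relP => -[x [y [xy xa yb]]];
  exists y, x; rewrite adj_sym.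
Qed.

Lemma copy_irr k : irreflexive (copy_rel k).
Proof.
move=> a; apply/copy_relP => -[x [y [xy xa ya]]].
by move: xy; rewrite (h_inj (etrans xa (esym ya))) adj_irr.
Qed.

Definition copy (k : K) : sgraph 'I_#|V| := SGraph (@copy_sym k) (@copy_irr k).

Lemma copy_isomorphic k : isomorphic (copy k) F.
Proof.
have [g gK Kg] : bijective (h k) by apply: inj_card_bij; rewrite ?card_ord.
exists g; split; first by exists (h k).
move=> a b; apply/idP/copy_relP => [ab|[x [y [xy <- <-]]]]; last by rewrite !gK.
by exists (g a), (g b); rewrite ab !Kg.
Qed.

(** The copies send pairs of an index and an arc of F injectively to ordered pairs of distinct
    vertices; by the count this injection is onto, so every edge is covered. *)
Lemma OP_solvable_packing :
  #|V| * #|V|.-1 <= #|K| * #|[set q : V * V | F q.1 q.2]| -> OP_solvable F.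
Proof.
move=> hcard; exists #|K|, (fun i => copy (enum_val i)); split; last first.
  by move=> i; apply: copy_isomorphic.
split.
  move=> i a b ab; apply/eqP => e; move: ab; rewrite e; exact/negP/negbT/copy_irr.
pose arcs := [set q : V * V | F q.1 q.2].
pose dom := finset.setX (finset.setTfor K) arcs.
pose m (t : K * (V * V)) := (h t.1 t.2.1, h t.1 t.2.2).
have m_inj : {in dom &, injective m}.
  move=> [k [x y]] [k' [x' y']]; rewrite !inE /= => xy xy' [ex ey].
  have ek := h_disjoint xy xy' ex ey; move: ex ey; rewrite -ek.
  by move=> /h_inj -> /h_inj ->.
pose cod := [set q : 'I_#|V| * 'I_#|V| | q.1 != q.2].
have cod_card : #|cod| = #|V| * #|V|.-1.
  have -> : cod = ~: [set (a, a) | a : 'I_#|V|].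
    apply/setP => -[a b]; rewrite !inE /=; congr (~~ _); apply/eqP/imsetP.
      by move=> ->; exists b.
    by case=> x _ [-> ->].
  rewrite cardsCs finset.setCK card_imset; last by move=> a b [].
  by rewrite card_prod !card_ord -{3}[#|V|]muln1 -mulnBr subn1.
have im_sub : m @: dom \subset cod.
  apply/subsetP => _ /imsetP[[k [x y]] + ->]; rewrite !inE /= => xy.
  by apply: contraTneq xy => /h_inj ->; rewrite adj_irr.
have im_eq : m @: dom = cod.
  apply/eqP; rewrite eqEcard im_sub cod_card (card_in_imset m_inj).
  by rewrite cardsX cardsT.
move=> a b ab; have : (a, b) \in cod by rewrite inE.
rewrite -im_eq => /imsetP[[k [x y]] + [-> ->]]; rewrite !inE /= => xy.
exists (enum_rank k); split.
  by apply/copy_relP; rewrite enum_rankK; exists x, y.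
move=> i /copy_relP[x' [y' [xy' ex ey]]]; apply: (canLR enum_valK).
exact: h_disjoint xy xy' (esym ex) (esym ey).
Qed.

End Packing.

Lemma card_arcs (V : finType) (F : sgraph V) d :
  is_regular d F -> #|[set q : V * V | F q.1 q.2]| = #|V| * d.
Proof.
move=> Fd; rewrite -sum1_card (eq_bigl (fun q : V * V => xpredT q.1 && F q.1 q.2)).
  rewrite -(pair_big_dep xpredT (fun x y => F x y) (fun _ _ => 1)) /=.
  rewrite (eq_bigr (fun=> d)) ?sum_nat_const // => x _; rewrite -(Fd x) -sum1_card.
  by apply: eq_bigl => y; rewrite inE.
by move=> q; rewrite inE.
Qed.

(** * The cubic Jacobi sum of a finite field *)

Import GRing.Theory Num.Theory.
Local Open Scope ring_scope.

Lemma dvdn_card_period (T : finType) (f : T -> T) (A : {pred T}) (n : nat) :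
  injective f -> (forall x, x \in A -> f x \in A) ->
  (forall x, x \in A -> fingraph.order f x = n) -> (n %| #|A|)%N.
Proof.
move=> injf closedA orderA.
rewrite -(@fcard_order_set _ _ injf n A) ?dvdn_mull //.
  by apply/subsetP => x xA; rewrite inE orderA.
apply: (intro_closed (fconnect_sym injf)) => x y /eqP <-; exact: closedA.
Qed.

Section JacobiSum.

Variable F : finFieldType.
Hypothesis card_mod6 : (#|F| %% 6 = 1)%N.

(** The cubic residue character, with values in the cube roots of unity of [F] itself instead of
    complex ones. *)
Definition cubic_symbol (x : F) : F := x ^+ (#|F|.-1 %/ 3).

Local Notation e := (#|F|.-1 %/ 3)%N.
Local Notation kappa := cubic_symbol.

Let card_gt1 : (1 < #|F|)%N := card_finRing_gt1 F.

Let e_gt0 : (0 < e)%N.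
Proof. by lia. Qed.

Let e3 : (e * 3 = #|F|.-1)%N.
Proof. by lia. Qed.

Lemma cubic_symbolM x y : kappa (x * y) = kappa x * kappa y.
Proof. exact: exprMn. Qed.

Lemma expf_card_pred (x : F) : x != 0 -> x ^+ #|F|.-1 = 1.
Proof.
by move=> hx; apply: (mulfI hx); rewrite mulr1 -exprS prednK ?expf_card // ltnW.
Qed.

Lemma cubic_symbol_eq0 x : (kappa x == 0) = (x == 0).
Proof. by rewrite /cubic_symbol expf_eq0 e_gt0. Qed.

Lemma cubic_symbol3 x : x != 0 -> kappa x ^+ 3 = 1.
Proof. by move=> hx; rewrite -exprM e3 expf_card_pred. Qed.

Lemma cubic_symbol_cube x : x != 0 -> kappa (x ^+ 3) = 1.
Proof. by move=> hx; rewrite /cubic_symbol -exprM mulnC e3 expf_card_pred. Qed.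

Lemma cubic_symbolN x : kappa (- x) = kappa x.
Proof.
have -> : - x = (-1) ^+ 3 * x by ring.
by rewrite cubic_symbolM cubic_symbol_cube ?mul1r // oppr_eq0 oner_neq0.
Qed.

(** Otherwise all 3e nonzero elements would be roots of ['X^e - 1]. *)
Lemma cubic_nonresidue : exists2 g : F, g != 0 & kappa g != 1.
Proof.
have [/existsP[g /andP[h1 h2]]|/existsPn h] :=
  boolP [exists g : F, (g != 0) && (kappa g != 1)]; first by exists g.
have := @max_poly_roots _ ('X^e - 1 : {poly F}) (enum [pred x : F | x != 0]).
have hsz : size ('X^e - 1 : {poly F}) = e.+1 by rewrite size_XnsubC.
rewrite -size_poly_eq0 hsz enum_uniq => /(_ isT).
have -> : all (root ('X^e - 1)) (enum [pred x : F | x != 0]).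
  apply/allP => x; rewrite mem_enum inE => hx; move: (h x); rewrite hx /= negbK.
  by rewrite /root !hornerE => /eqP; rewrite /cubic_symbol => ->; rewrite subrr.
by move=> /(_ isT isT); rewrite -cardE cardC1 -e3; move: e_gt0; set k := (_ %/ _)%N; lia.
Qed.

Lemma cubic_symbol_values (w z : F) :
  w ^+ 3 = 1 -> w != 1 -> z ^+ 3 = 1 -> z \in [:: 1; w; w ^+ 2].
Proof.
move=> hw hw1 hz; have hw2 : w ^+ 2 + w + 1 = 0.
  apply: (mulfI (x := w - 1)); first by rewrite subr_eq0.
  by transitivity (w ^+ 3 - 1); [ring | rewrite hw; ring].
have : (z - 1) * ((z - w) * (z - w ^+ 2)) == 0.
  apply/eqP; transitivity
    ((z ^+ 3 - 1) + (w ^+ 2 + w + 1) * (z - z ^+ 2) + (w ^+ 3 - 1) * (z - 1)).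
    ring.
  by rewrite hz hw hw2; ring.
by rewrite !mulf_eq0 !subr_eq0 !inE.
Qed.

(* The trace (from the cyclotomic integers) of a cubic character. *)
Let psi (x : F) : int := if kappa x == 1 then 2 else -1.

(** For a nonresidue [g], the symbols of x, g x and g^2 x are the three cube roots of unity, with
    traces 2, -1, -1. Adding three reindexed copies of the sum therefore gives 0. *)
Let sum_psi (c : F) : c != 0 -> \sum_(x : F | x != 0) psi (c * x) = 0.
Proof.
move=> hc; have [g hg hg1] := cubic_nonresidue.
have sumg (d : F) : d != 0 ->
    \sum_(x : F | x != 0) psi (d * x) = \sum_(x : F | x != 0) psi x.
  move=> hd; rewrite [RHS](reindex_onto (fun x => d * x) (fun x => d^-1 * x)) /=.
    apply: eq_bigl => x; rewrite mulKf // eqxx andbT mulf_eq0 (negbTE hd) //.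
  by move=> x _; rewrite mulVKf.
rewrite sumg //; set s := \sum_(_ | _) _.
suff : s + (s + s) = 0 by lia.
have -> : s + (s + s) =
    \sum_(x : F | x != 0) (psi x + (psi (g * x) + psi (g * g * x))).
  by rewrite !big_split /= !sumg ?mulf_neq0.
apply: big1 => x hx; rewrite /psi !cubic_symbolM.
have := @cubic_symbol_values (kappa g) (kappa x) (cubic_symbol3 hg) hg1 (cubic_symbol3 hx).
have hg3 : kappa g * kappa g * kappa g = 1 by rewrite -(cubic_symbol3 hg); ring.
have hg2 : (kappa g * kappa g == 1) = false.
  by apply/negbTE/eqP => h; move/eqP: hg1; apply; rewrite -hg3 h mul1r.
rewrite !inE => /or3P[] /eqP ->.
- by rewrite !mulr1 eqxx (negbTE hg1) hg2.
- by rewrite hg3 eqxx hg2 (negbTE hg1).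
- by rewrite expr2 !mulrA hg3 mul1r eqxx hg2 (negbTE hg1).
Qed.

Let inX : pred F := [pred x | (x != 0) && (x != 1)].

Let sum_psiX (c : F) : c != 0 -> \sum_(x | inX x) psi (c * x) = - psi c.
Proof.
move=> hc; have := sum_psi hc; rewrite (bigD1 1) ?oner_neq0 //= mulr1.
by move/eqP; rewrite addr_eq0 => /eqP ->; rewrite opprK.
Qed.

Let psi1 : psi 1 = 2.
Proof. by rewrite /psi /cubic_symbol expr1n eqxx. Qed.

Let psi_sqr x : x != 0 -> psi (x * x) = psi x.
Proof.
move=> hx; rewrite /psi cubic_symbolM; congr (if _ then _ else _).
apply/eqP/eqP => [h|->]; last by rewrite mulr1.
by rewrite -(cubic_symbol3 hx) !exprS expr0 mulr1 h mulr1.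
Qed.

Let cardX : #|inX| = (#|F| - 2)%N.
Proof.
have := cardC1 (0 : F); rewrite (cardD1 1) !inE oner_neq0 add1n => h.
rewrite subn2 -h /=; apply: eq_card => x; rewrite !inE /= andbC //.
Qed.

Let f (x : F) : F := x * (1 - x).

Let f_neq0 x : inX x -> f x != 0.
Proof. by case/andP=> h0 h1; rewrite mulf_neq0 // subr_eq0 eq_sym. Qed.

(* |J|^2 = #|F| for the Jacobi sum J, by the substitution s = x / y,
   t = (1 - x) / (1 - y) in the double sum. *)
Let jacobi_norm :
  \sum_(x | inX x) \sum_(y | inX y) psi (f x / f y) = 2 * #|F|%:Z.
Proof.
have diag : \sum_(x | inX x) psi (f x / f x) = 2 * (#|F| - 2)%N%:Z.
  rewrite (eq_bigr (fun=> 2)); last by move=> x hx; rewrite divff ?f_neq0.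
  by rewrite sumr_const cardX; lia.
have offdiag : \sum_(q : F * F | inX q.1 && inX q.2 && (q.1 != q.2))
    psi (f q.1 / f q.2) =
    \sum_(q : F * F | inX q.1 && inX q.2 && (q.1 != q.2)) psi (q.1 * q.2).
  (* Solving s = x / y and t = (1 - x) / (1 - y) gives y = (1 - t) / (s - t) and x = s y. *)
  pose h (q : F * F) := (q.1 * ((1 - q.2) / (q.1 - q.2)), (1 - q.2) / (q.1 - q.2)).
  pose h' (q : F * F) := (q.1 / q.2, (1 - q.1) / (1 - q.2)).
  rewrite (reindex_onto h h') /=; last first.
    case=> x y /= /andP[/andP[/andP[x0 x1] /andP[y0 y1]] xy].
    have y1' : 1 - y != 0 by rewrite subr_eq0 eq_sym.
    have d0 : x * (1 - y) - (1 - x) * y != 0.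
      by rewrite (_ : _ - _ = x - y); [rewrite subr_eq0 | ring].
    have d1 : x / y - (1 - x) / (1 - y) != 0.
      have -> : x / y - (1 - x) / (1 - y) = (x * (1 - y) - (1 - x) * y) / (y * (1 - y)).
        by field; rewrite y0 y1'.
      by rewrite mulf_neq0 // invr_eq0 mulf_neq0.
    rewrite /h /=; have -> : (1 - (1 - x) / (1 - y)) / (x / y - (1 - x) / (1 - y)) = y.
      by apply: (mulIf d1); rewrite divfK //; field; rewrite y0 y1'.
    by rewrite divfK.
  have fE x y : f x / f y = (x / y) * ((1 - x) / (1 - y)).
    by rewrite /f invfM mulrACA.
  apply: eq_big => [[s t]|[s t]]; rewrite /h' /h /=; last first.
    by case/andP=> _ /eqP[]; rewrite fE => -> ->.
  apply/idP/idP.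
    case/andP=> /andP[/andP[/andP[x0 x1] /andP[y0 y1]] xy] /eqP[].
    (* Here division by zero gives 0, so s = t would make y zero. *)
    have st : s != t.
      by apply: contraNneq y0 => ->; rewrite subrr invr0 mulr0.
    move: x0 x1 y0 y1 xy; set y := (1 - t) / (s - t); set x := s * y.
    move=> x0 x1 y0 y1 xy hs ht; rewrite st andbT.
    have s0 : s != 0 by rewrite -hs mulf_neq0 // invr_eq0.
    have s1 : s != 1 by apply: contraNneq xy => s1; rewrite /x s1 mul1r.
    have t0 : t != 0.
      by rewrite -ht mulf_neq0 // ?invr_eq0 subr_eq0 eq_sym.
    have t1 : t != 1 by apply: contraNneq y0 => t1; rewrite /y t1 subrr mul0r.
    by rewrite /inX /= s0 s1 t0 t1.
  case/andP=> /andP[/andP[s0 s1] /andP[t0 t1]] st.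
  have st0 : s - t != 0 by rewrite subr_eq0.
  have s10 : s - 1 != 0 by rewrite subr_eq0.
  set y := (1 - t) / (s - t); set x := s * y.
  have y0 : y != 0 by rewrite mulf_neq0 ?invr_eq0 // subr_eq0 eq_sym.
  have y1E : 1 - y = (s - 1) / (s - t) by rewrite /y; field.
  have x1E : 1 - x = t * (1 - y) by rewrite y1E /x /y; field.
  have y1 : 1 - y != 0 by rewrite y1E mulf_neq0 ?invr_eq0.
  have x1 : 1 - x != 0 by rewrite x1E mulf_neq0.
  have [x0 x1' y1'] : [/\ x != 0, x != 1 & y != 1].
    by split; [exact: mulf_neq0 | rewrite eq_sym -subr_eq0 ..].
  rewrite x1E !mulfK // eqxx andbT /inX /= x0 x1' y0 y1' /=.
  have -> : (x != y) = ((s - 1) * y != 0) by rewrite mulrBl mul1r subr_eq0.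
  by rewrite mulf_neq0.
have inner : \sum_(x | inX x) \sum_(y | inX y) psi (x * y) = 2.
  rewrite (eq_bigr (fun x => - psi x)); last by move=> x /andP[hx _]; exact: sum_psiX.
  rewrite sumrN; have := sum_psiX (oner_neq0 F).
  by rewrite (eq_bigr psi) => [->|x _]; rewrite ?mul1r // opprK psi1.
have sumX : \sum_(x | inX x) psi x = - 2.
  rewrite -psi1 -(sum_psiX (oner_neq0 F)).
  by apply: eq_bigr => x _; rewrite mul1r.
have split (G : F -> F -> int) : \sum_(x | inX x) \sum_(y | inX y) G x y =
    \sum_(x | inX x) G x x +
    \sum_(q : F * F | inX q.1 && inX q.2 && (q.1 != q.2)) G q.1 q.2.
  rewrite (pair_big_dep inX (fun=> inX)) /=.
  rewrite (bigID (fun q : F * F => q.1 == q.2)) /=; congr +%R.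
  rewrite (reindex_onto (fun x => (x, x)) fst) /=; last first.
    by move=> [x y] /= /andP[_ /eqP ->].
  by apply: eq_bigl => x; rewrite !eqxx !andbT andbb.
(* The full sum of psi (x y) is 2 and its diagonal is -2, so the off-diagonal part is 4; with the
   diagonal 2 (q - 2) this gives 2 q, where q is the order of [F]. *)
move: inner; rewrite !split diag offdiag.
rewrite (eq_bigr psi); last by move=> x /andP[hx _]; exact: psi_sqr.
rewrite sumX; move: (\sum_(_ | _) _) (#|F|) card_gt1 => S n; lia.
Qed.

Let level (z : F) : {pred F} := [pred x | inX x && (kappa (f x) == z)].

(** The maps x -> 1 - x and x -> 1 / (1 - x), of orders 2 and 3, preserve the level sets of
    [kappa (f x)]. Their fixed points all have symbol 1, so 2 and 3 both divide the size of any
    other level. *)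
Let card_level6 (c z : F) : c ^+ 3 = 2 -> z != 1 -> (6 %| #|level z|)%N.
Proof.
move=> hc hz; rewrite -[6%N]/(2 * 3)%N Gauss_dvd //; apply/andP; split.
  apply: (@dvdn_card_period _ (fun x => 1 - x)) => [x y /addrI/oppr_inj //|x|x].
    rewrite /level /inX !inE /= => /andP[/andP[x0 x1] hx].
    rewrite subr_eq0 eq_sym x1 -subr_eq0 (_ : 1 - x - 1 = - x); last by ring.
    rewrite oppr_eq0 x0 /= (_ : f (1 - x) = f x) //; rewrite /f; ring.
  rewrite inE => /andP[/andP[x0 x1] /eqP hx].
  apply: (@order_cycle _ _ [:: x; 1 - x]); rewrite /= ?inE ?eqxx //.
    by rewrite (_ : 1 - (1 - x) = x) ?eqxx //; ring.
  (* A fixed point is x = 1/2, where f x = 1/4 is a cube because 2 is one. *)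
  rewrite andbT; apply: contraNneq hz => xE.
  have hx2 : 2 * x = 1 by rewrite -[RHS](subrK x) -xE; ring.
  have c0 : c != 0.
    apply: contra_eq_neq hx2 => c0; rewrite -hc c0 expr0n mul0r eq_sym.
    exact: oner_neq0.
  have h2 : kappa 2 = 1 by rewrite -hc cubic_symbol_cube.
  have : kappa (2 * 2 * f x) = 1.
    rewrite (_ : 2 * 2 * f x = 1) ?/cubic_symbol ?expr1n //.
    rewrite /f -xE; transitivity ((2 * x) * (2 * x)); first by ring.
    by rewrite hx2 mulr1.
  by rewrite cubic_symbolM hx cubic_symbolM h2 !mul1r => ->.
pose g (x : F) := (1 - x)^-1.
have gE x : inX x -> 1 - g x = - x / (1 - x).
  by case/andP=> x0 x1; rewrite /g; field; rewrite subr_eq0 eq_sym.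
have gX x : x \in level z -> g x \in level z.
  rewrite /level !inE => /andP[hX hx]; have [x0 x1] := andP hX.
  have x1' : 1 - x != 0 by rewrite subr_eq0 eq_sym.
  have gx1 : 1 - g x != 0 by rewrite gE // mulf_neq0 ?oppr_eq0 ?invr_eq0.
  have -> : inX (g x).
    by rewrite /inX /= invr_eq0 x1' eq_sym -subr_eq0.
  (* The extra factor is a cube, and so is -1. *)
  have -> : f (g x) = - (f x * (1 - x)^-1 ^+ 3).
    by rewrite [in LHS]/f gE // /f /g; field.
  by rewrite cubic_symbolN cubic_symbolM cubic_symbol_cube ?mulr1 // invr_eq0.
have g3 x : x \in level z -> g (g (g x)) = x.
  rewrite inE => /andP[hX _]; have [x0 x1] := andP hX.
  have x1' : 1 - x != 0 by rewrite subr_eq0 eq_sym.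
  rewrite [LHS]/g (_ : 1 - g (g x) = x^-1) ?invrK //.
  have -> : g (g x) = (1 - x) / - x by rewrite {1}/g gE // invf_div.
  by field; rewrite ?oppr_eq0 x0.
have g1 x : x \in level z -> g x != x.
  rewrite inE => /andP[/andP[x0 x1] /eqP hx]; apply: contraNneq hz => gx.
  have x1' : 1 - x != 0 by rewrite subr_eq0 eq_sym.
  have fx : f x = 1 by rewrite /f -{1}gx mulVf.
  by rewrite -hx fx /cubic_symbol expr1n.
apply: (@dvdn_card_period _ g) => [x y /invr_inj/addrI/oppr_inj //|//|x hx].
apply: (@order_cycle _ _ [:: x; g x; g (g x)]); rewrite /= ?inE ?eqxx //.
  by rewrite g3 // eqxx.
have := g1 _ (gX _ hx); rewrite eq_sym => ->; have := g1 _ hx; rewrite eq_sym => h.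
rewrite negb_or h !andbT /=; apply: contra_neq h => gg.
by rewrite -{1}[x]g3 // -gg.
Qed.

(** With level sizes n, 6a, 6b the Jacobi sum is n + 6 a omega + 6 b omega^2, omega a complex
    primitive cube root of unity. Its norm (n - 3a - 3b)^2 + 27 (a - b)^2 is the order of the
    field. *)
Theorem card_x2_27y2 (c : F) :
  c ^+ 3 = 2 -> exists x y : int, #|F|%:Z = x ^+ 2 + 27 * y ^+ 2.
Proof.
move=> hc; have [g hg hg1] := cubic_nonresidue.
set w := kappa g in hg1; have w3 : w ^+ 3 = 1 := cubic_symbol3 hg.
have w2 : w ^+ 2 != 1.
  by apply: contraNneq hg1 => h; rewrite -w3 exprS h mulr1.
have w0 : w != 0 by rewrite cubic_symbol_eq0.
have w12 : w ^+ 2 != w by rewrite expr2 -subr_eq0 -{3}[w]mulr1 -mulrBr mulf_neq0 ?subr_eq0.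
have levelE z x : (x \in level z) = inX x && (kappa (f x) == z) by [].
have sumX (G : F -> int) : \sum_(x | inX x) G (kappa (f x)) =
    #|level 1|%:Z * G 1 + #|level w|%:Z * G w + #|level (w ^+ 2)|%:Z * G (w ^+ 2).
  rewrite (bigID (fun x => kappa (f x) == 1)) /= -addrA; congr +%R.
    rewrite (eq_bigr (fun=> G 1)); last by move=> x /andP[_ /eqP ->].
    by rewrite sumr_const -mulr_natl; congr (_ * _); rewrite natz.
  rewrite (bigID (fun x => kappa (f x) == w)) /=; congr +%R.
    rewrite (eq_bigr (fun=> G w)); last by move=> x /andP[_ /eqP ->].
    rewrite sumr_const -mulr_natl natz; congr (Posz _ * _); apply: eq_card => x.
    rewrite levelE unfold_in /=.
    by case: (eqVneq (kappa (f x)) w) => [->|_]; rewrite ?hg1 ?andbT ?andbF.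
  have in3 x : inX x -> [|| kappa (f x) == 1, kappa (f x) == w | kappa (f x) == w ^+ 2].
    move=> /f_neq0/cubic_symbol3 /(cubic_symbol_values w3 hg1).
    by rewrite !inE.
  rewrite (eq_bigr (fun=> G (w ^+ 2))); last first.
    move=> x /andP[/andP[/in3 + n1] nw]; rewrite (negbTE n1) (negbTE nw) /=.
    by move/eqP->.
  rewrite sumr_const -mulr_natl natz; congr (Posz _ * _); apply: eq_card => x.
  rewrite levelE unfold_in -andbA; case hX: (inX x) => //=.
  have := in3 x hX; case: eqVneq => [->|_] /=; first by rewrite eq_sym (negbTE w2).
  by case: eqVneq => [-> _|_ /= ->] //=; rewrite eq_sym (negbTE w12).
(* In this form the double sum depends only on the sizes of the three levels. *)
have psiE x y : inX y -> psi (f x / f y) = 3 * (kappa (f x) == kappa (f y))%:Z - 1.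
  move=> /f_neq0 hy; rewrite /psi cubic_symbolM.
  have -> : kappa (f y)^-1 = (kappa (f y))^-1 by rewrite /cubic_symbol exprVn.
  have hky : kappa (f y) != 0 by rewrite cubic_symbol_eq0.
  by rewrite -(inj_eq (mulIf hky)) divfK // mul1r; case: eqP.
have := jacobi_norm.
under eq_bigr => x _.
  under eq_bigr => y hy do rewrite psiE //.
  rewrite (sumX (fun z => 3 * (kappa (f x) == z)%:Z - 1)).
  over.
rewrite (sumX (fun z => #|level 1|%:Z * (3 * (z == 1)%:Z - 1) +
  #|level w|%:Z * (3 * (z == w)%:Z - 1) +
  #|level (w ^+ 2)|%:Z * (3 * (z == w ^+ 2)%:Z - 1))).
rewrite !eqxx !(eq_sym 1) !(eq_sym w (w ^+ 2)) (negbTE hg1) (negbTE w2) (negbTE w12).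
have /dvdnP[a ->] := card_level6 hc hg1.
have /dvdnP[b ->] := card_level6 hc w2.
move: #|level 1| => n hN; exists (n%:Z - 3 * a%:Z - 3 * b%:Z), (a%:Z - b%:Z).
rewrite !expr2; move: hN; rewrite /= !PoszM; lia.
Qed.

End JacobiSum.

(** * Primes for which 2, 3 and 6 are not cubes *)

Lemma dvdz_prime_mul (p : nat) (a b : int) :
  prime p -> (p %| a * b)%Z = (p %| a)%Z || (p %| b)%Z.
Proof. by move=> hp; rewrite !dvdzE abszM Euclid_dvdM. Qed.

(* Division of U + V sqrt(-3) by one of the two factors x +- z sqrt(-3) of p. *)
Lemma norm_form_quotient (p : nat) (m U V x z : int) :
  prime p -> p%:Z = x ^+ 2 + 3 * z ^+ 2 -> m * p%:Z = U ^+ 2 + 3 * V ^+ 2 ->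
  exists z' U' V' : int, [/\ z' = z \/ z' = - z, m = U' ^+ 2 + 3 * V' ^+ 2
                           & V = x * V' + z' * U'].
Proof.
move=> hp hxz hUV.
have p0 : p%:Z != 0 by have := prime_gt0 hp; lia.
(* The product is x^2 V^2 - z^2 U^2, and x^2 = -3 z^2, U^2 = -3 V^2 modulo p. The factor divisible
   by p decides the sign of z. *)
have : (p %| (x * V - z * U) * (x * V - (- z) * U))%Z.
  apply/dvdzP; exists (V ^+ 2 - z ^+ 2 * m).
  transitivity (V ^+ 2 * p%:Z - z ^+ 2 * (m * p%:Z)); last by ring.
  by rewrite hUV hxz; ring.
rewrite dvdz_prime_mul // => hdvd.
have [z' hz' /dvdzP[V' hV']] :
    exists2 z', z' = z \/ z' = - z & (p %| x * V - z' * U)%Z.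
  by case/orP: hdvd => h; [exists z => //; left | exists (- z) => //; right].
have hxz' : p%:Z = x ^+ 2 + 3 * z' ^+ 2 by case: hz' => ->; rewrite ?sqrrN.
have : (p %| (x * U + 3 * z' * V) * (x * U + 3 * z' * V))%Z.
  apply/dvdzP; exists (m * p%:Z - 3 * V' ^+ 2 * p%:Z).
  have -> : (x * U + 3 * z' * V) * (x * U + 3 * z' * V) =
      (x ^+ 2 + 3 * z' ^+ 2) * (U ^+ 2 + 3 * V ^+ 2) - 3 * (x * V - z' * U) ^+ 2 by ring.
  by rewrite -hxz' -hUV hV'; ring.
rewrite dvdz_prime_mul // orbb => /dvdzP[U' hU'].
exists z', U', V'; split=> //; last first.
  apply: (mulIf p0).
  transitivity (x * (V' * p%:Z) + z' * (U' * p%:Z)); last by ring.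
  by rewrite -hU' -hV' hxz'; ring.
apply: (mulIf p0); apply: (mulIf p0); rewrite hUV.
have -> : (U' ^+ 2 + 3 * V' ^+ 2) * p%:Z * p%:Z =
    (U' * p%:Z) ^+ 2 + 3 * (V' * p%:Z) ^+ 2 by ring.
by rewrite -hU' -hV' hxz'; ring.
Qed.

(** Induction on n, dividing out one prime at a time: in V = x V' + z' U' the integer z' = +-3 y is
    divisible by 3, and V' is by induction. *)
Lemma norm_form_dvd3 (n : nat) (U V : int) :
  n%:Z = U ^+ 2 + 3 * V ^+ 2 ->
  (forall p, prime p -> (p %| n)%N ->
     exists x y : int, p%:Z = x ^+ 2 + 27 * y ^+ 2) ->
  (3 %| V)%Z.
Proof.
elim/ltn_ind: n U V => n IH U V hn hprimes.
case: (leqP n 1) => [n1|n1].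
  have -> : V = 0 by move: hn; rewrite !expr2; nia.
  exact: dvdz0.
have hp := pdiv_prime n1; have /dvdnP[m hm] := pdiv_dvd n.
have [x [y hxy]] := hprimes _ hp (pdiv_dvd n).
have hxz : (pdiv n)%:Z = x ^+ 2 + 3 * (3 * y) ^+ 2 by rewrite hxy; ring.
have hUV : m%:Z * (pdiv n)%:Z = U ^+ 2 + 3 * V ^+ 2 by rewrite -hn -PoszM -hm.
have [z' [U' [V' [hz' hm' ->]]]] := norm_form_quotient hp hxz hUV.
have m_gt0 : (0 < m)%N.
  by case: (posnP m) => // m0; move: n1; rewrite hm m0.
have m_lt : (m < n)%N by rewrite [X in (_ < X)%N]hm ltn_Pmulr // prime_gt1.
have hV' : (3 %| V')%Z.
  apply: (IH m m_lt U' V' hm') => q hq hqm; apply: hprimes => //.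
  by rewrite hm dvdn_mulr.
apply: rpredD; first exact: dvdz_mull.
by apply: dvdz_mulr; case: hz' => ->; rewrite ?rpredN dvdz_mulr.
Qed.

Lemma unit_cubesP (p : nat) (a : 'F_p) :
  reflect (exists2 c : 'F_p, c != 0 & a = c ^+ 3) (a \in unit_cubes p).
Proof.
apply: (iffP imsetP) => [[u _ ->]|[c hc ->]].
  exists (val u); first by rewrite -unitfE (valP u).
  exact: FinRing.val_unitX.
have hu : c \is a GRing.unit by rewrite unitfE.
exists (FinRing.unit 'F_p hu); first by rewrite inE.
by rewrite FinRing.val_unitX.
Qed.

(** * Prime divisors of 16 b^6 + 3 *)

Section PrimeDivisor.

Variables b p : nat.
Hypothesis p_prime : prime p.
Hypothesis p_dvd : (p %| 16 * b ^ 6 + 3)%N.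
Hypothesis p_not3 : p != 3.

Let natF n : (n%:R == 0 :> 'F_p) = (p %| n)%N.
Proof. by rewrite (dvdn_pcharf (pchar_Fp p_prime)). Qed.

Let p_not2 : p != 2.
Proof. by apply: contraTneq p_dvd => ->; rewrite dvdn2; lia. Qed.

Let two_neq0 : 2 != 0 :> 'F_p.
Proof. by rewrite natF; apply: contraNN p_not2; rewrite dvdn_prime2. Qed.

Let three_neq0 : 3 != 0 :> 'F_p.
Proof. by rewrite natF; apply: contraNN p_not3; rewrite dvdn_prime2. Qed.

Let four_neq0 : 4 != 0 :> 'F_p.
Proof. by rewrite (_ : 4 = 2 * 2) ?mulf_neq0 //; ring. Qed.

Let B : 'F_p := b%:R.

Let B6 : 16 * B ^+ 6 = - 3.
Proof.
apply/eqP; rewrite -subr_eq0 opprK -natrX -natrM -natrD natF; exact: p_dvd.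
Qed.

Let B_neq0 : B != 0.
Proof.
by apply: contraNneq three_neq0 => h; rewrite -[3]opprK -B6 h expr0n mulr0 oppr0.
Qed.

(* 4 b^3 is a square root of -3, so (4 b^3 - 1) / 2 has order 3. *)
Lemma prime_divisor_mod6 : p = 1 %[mod 6].
Proof.
have p_odd : odd p by case: (even_prime p_prime) => // /eqP; rewrite (negbTE p_not2).
have : (p %% 3 != 0)%N.
  by apply: contraNneq p_not3 => /eqP; rewrite -/(3 %| p)%N dvdn_prime2 // eq_sym.
have : (p %% 3 != 2)%N; last by lia.
apply/eqP => p3; pose w : 'F_p := (4 * B ^+ 3 - 1) / 2.
have w2 : w ^+ 2 + w + 1 = 0.
  have -> : w ^+ 2 + w + 1 = (16 * B ^+ 6 + 3) / 4.
    by rewrite /w; field; rewrite two_neq0 four_neq0.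
  by rewrite B6 addNr mul0r.
have w3 : w ^+ 3 = 1.
  have -> : w ^+ 3 = (w - 1) * (w ^+ 2 + w + 1) + 1 by ring.
  by rewrite w2 mulr0 add0r.
have w0 : w != 0.
  by apply: contra_eq_neq w3 => ->; rewrite expr0n eq_sym oner_neq0.
have := expf_card_pred w0; rewrite card_Fp //.
have -> : p.-1 = (3 * (p %/ 3) + 1)%N by lia.
rewrite exprD exprM w3 expr1n mul1r expr1 => w1.
by move: w2; rewrite w1 expr1n => /eqP; rewrite (_ : 1 + 1 + 1 = 3) ?(negbTE three_neq0) //; ring.
Qed.

(** From 16 B^6 = -3, a cube root of 3 or of 6 would produce one of 2. *)
Lemma prime_divisor_noncube :
  (forall c : 'F_p, c ^+ 3 != 2) -> noncube_primes p.
Proof.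
move=> h2; split=> //; first exact: prime_divisor_mod6.
- by apply/unit_cubesP => -[c _ hc]; move: (h2 c); rewrite -hc eqxx.
(* If c^3 = 3 then - c^3 = 16 B^6 = 2 (2 B^2)^3. *)
- apply/unit_cubesP => -[c _ hc]; have /eqP := h2 (- c / (2 * B ^+ 2)); apply.
  have k0 : 2 * B ^+ 2 != 0 by rewrite mulf_neq0 // expf_neq0.
  apply: (mulIf (expf_neq0 3 k0)); rewrite -exprMn divfK //.
  transitivity (- c ^+ 3); first by ring.
  by rewrite -hc -B6; ring.
(* If c^3 = 6 then - (4 B^2)^3 = -4 (16 B^6) = 12 = 2 c^3. *)
- apply/unit_cubesP => -[c c0 hc]; have /eqP := h2 (- (4 * B ^+ 2) / c); apply.
  apply: (mulIf (expf_neq0 3 c0)); rewrite -exprMn divfK // -hc.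
  transitivity (- 4 * (16 * B ^+ 6)); first by ring.
  by rewrite B6; ring.
Qed.

End PrimeDivisor.

Lemma exists_noncube_prime (N : nat) : exists2 p, noncube_primes p & (N < p)%N.
Proof.
(* The part of N! prime to 3: any prime up to N other than 3 divides [b], hence does not divide [n],
   and neither does 3. *)
pose b := ((N`!)`_(3^'))%N; pose n := (16 * b ^ 6 + 3)%N.
have b_coprime3 : coprime 3 b.
  by rewrite prime_coprime // -p'natE // part_pnat.
have n3 p : prime p -> (p %| n)%N -> p != 3.
  move=> hp pn; apply/eqP => p3; move: pn; rewrite p3 /n dvdn_addl //.
  rewrite Gauss_dvdr // Euclid_dvdX // andbT; apply/negP.
  by rewrite -prime_coprime.
have [/hasP[p hp h2]|/hasPn all2] :=
  boolP (has (fun p => [forall c : 'F_p, c ^+ 3 != 2]) (primes n)).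
  move: hp; rewrite mem_primes => /and3P[hp _ pn].
  exists p; first by apply: (prime_divisor_noncube hp pn (n3 p hp pn)); apply/forallP.
  rewrite ltnNge; apply/negP => pN; have p3 := n3 p hp pn.
  have pb : (p %| b)%N.
    have : (p %| N`!)%N by rewrite dvdn_fact // prime_gt0.
    rewrite -(partnC 3%N (fact_gt0 N)) Gauss_dvdr // p_part coprimeXr //.
    by rewrite prime_coprime // dvdn_prime2.
  have pb6 : (p %| 16 * b ^ 6)%N by rewrite dvdn_mull // dvdn_exp.
  by move: pn; rewrite /n dvdn_addr // dvdn_prime2 // (negbTE p3).
(* Now 2 is a cube modulo every prime factor of [n], so the imaginary part 1 of 4 b^3 + sqrt(-3)
   would be divisible by 3. *)
suff : (3 %| 1)%Z by [].
apply: (@norm_form_dvd3 n (4 * b%:Z ^+ 3) 1); first by rewrite /n; lia.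
move=> p hp pn; have := all2 p; rewrite mem_primes hp pn /=.
have -> /= : (0 < n)%N by rewrite /n; lia.
case/(_ isT)/forallPn => c; rewrite negbK => /eqP hc.
have := @card_x2_27y2 'F_p _ c hc; rewrite card_Fp //; apply.
by have := prime_divisor_mod6 hp pn (n3 p hp pn).
Qed.

Theorem infinite_noncube_primes : infinite_set noncube_primes.
Proof.
move=> /finite_seqP[s hs].
have [p hp ltp] := exists_noncube_prime (\max_(q <- s) q).
have ps : p \in s by move: hp; rewrite hs.
move: ltp; rewrite ltnNge => /negP; apply.
exact: (@leq_bigmax_seq _ s xpredT id).
Qed.

(** * Multiplying by cubes *)

Section NonzeroCubes.

Variable F : finFieldType.
Hypothesis two_neq0 : 2 != 0 :> F.

Definition nonzero_cubes : {set F} := [set x ^+ 3 | x : F & x != 0].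

(** Each fibre of cubing consists of roots of a cubic polynomial. *)
Lemma card_nonzero_cubes : (#|F|.-1 <= 3 * #|nonzero_cubes|)%N.
Proof.
rewrite -(cardC1 (0 : F)) -[X in (X <= _)%N]sum1_card.
rewrite (partition_big (fun x => x ^+ 3) (mem nonzero_cubes)) /=; last first.
  by move=> x x0; apply/imsetP; exists x => //; move: x0; rewrite !inE.
rewrite mulnC -sum_nat_const; apply: leq_sum => c _; rewrite sum1_card cardE.
have sz : size ('X^3 - c%:P : {poly F}) = 4%N by rewrite size_XnsubC.
rewrite -ltnS -sz; apply: max_poly_roots; last exact: enum_uniq.
  by rewrite -size_poly_eq0 sz.
apply/allP => x; rewrite mem_enum unfold_in => /andP[_ /eqP xc].
by rewrite /root !hornerE xc subrr.
Qed.

(* The order [enum_rank] only serves to pick one element of each pair {u, -u}. *)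
Definition half_cubes : {set F} :=
  [set u in nonzero_cubes | (enum_rank u < enum_rank (- u))%N].

Lemma half_cubes_opp u v : u \in half_cubes -> v \in half_cubes -> u != - v.
Proof.
rewrite !inE => /andP[_ hu] /andP[_ hv]; apply: contraTneq hu => ->.
by rewrite opprK -leqNgt ltnW.
Qed.

(** The cubes are closed under negation, so they are covered by [half_cubes] and its negative; x =
    -x is excluded since 2 is nonzero. *)
Lemma card_half_cubes : (#|F|.-1 <= 6 * #|half_cubes|)%N.
Proof.
apply: leq_trans card_nonzero_cubes _.
rewrite -[6%N]/(3 * 2)%N -mulnA leq_mul2l /= mul2n -addnn.
have cubesN x : x \in nonzero_cubes -> - x \in nonzero_cubes.
  case/imsetP=> y; rewrite inE => y0 ->; apply/imsetP; exists (- y).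
    by rewrite inE oppr_eq0.
  by ring.
apply: leq_trans (_ : #|half_cubes :|: -%R @: half_cubes| <= _)%N; last first.
  by apply: leq_trans (leq_card_setU _ _) _; rewrite leq_add2l leq_imset_card.
apply: subset_leq_card; apply/subsetP => x hx.
have x0 : x != 0.
  by case/imsetP: hx => y; rewrite inE => y0 ->; rewrite expf_neq0.
rewrite finset.in_setU; case: (ltngtP (enum_rank x) (enum_rank (- x))) => h.
- by rewrite inE hx h.
- apply/orP; right; apply/imsetP; exists (- x); rewrite ?opprK //.
  by rewrite inE cubesN // opprK.
- case/negP: x0; move/val_inj/enum_rank_inj: h => h.
  rewrite -(inj_eq (mulfI two_neq0)) mulr0 mulr_natl mulr2n {1}h addNr //.
Qed.

Lemma nonzero_cubesM x y :
  x \in nonzero_cubes -> y \in nonzero_cubes -> x * y \in nonzero_cubes.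
Proof.
case/imsetP=> a; rewrite inE => a0 -> /imsetP[b]; rewrite inE => b0 ->.
by apply/imsetP; exists (a * b); rewrite ?inE ?mulf_neq0 ?exprMn.
Qed.

Lemma nonzero_cubesV x : x \in nonzero_cubes -> x^-1 \in nonzero_cubes.
Proof.
case/imsetP=> a; rewrite inE => a0 ->.
by apply/imsetP; exists a^-1; rewrite ?inE ?invr_eq0 ?exprVn.
Qed.

Lemma nonzero_cubes_expr3 x : x != 0 -> x ^+ 3 \in nonzero_cubes.
Proof. by move=> x0; apply/imsetP; exists x; rewrite ?inE. Qed.

End NonzeroCubes.

(* Modulo cubes 4/3 is 6^2, so 1, 3 and 4 lie in distinct cosets of the cubes. *)
Lemma diffs_quotient_noncube (F : finFieldType) (d d' : nat) :
  2 \notin nonzero_cubes F -> 3 \notin nonzero_cubes F ->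
  6 \notin nonzero_cubes F -> 2 != 0 :> F -> 3 != 0 :> F ->
  d \in diffs -> d' \in diffs -> d%:R / d'%:R \in nonzero_cubes F -> d = d'.
Proof.
move=> c2 c3 c6 two_neq0 three_neq0.
have four_neq0 : 4 != 0 :> F by rewrite (_ : 4 = 2 * 2) ?mulf_neq0 //; ring.
have six_neq0 : 6 != 0 :> F by rewrite (_ : 6 = 2 * 3) ?mulf_neq0 //; ring.
have c4 : 4 \notin nonzero_cubes F.
  apply: contra c2 => /nonzero_cubesV/(nonzero_cubesM (nonzero_cubes_expr3 two_neq0)).
  by rewrite (_ : 2 ^+ 3 / 4 = 2) //; field.
(* Multiplied by 3^3 it is 6^2, and 6^3 / 6^2 = 6 is not a cube. *)
have c43 : 4 / 3 \notin nonzero_cubes F.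
  apply: contra c6 => /nonzero_cubesM/(_ (nonzero_cubes_expr3 three_neq0)).
  move=> /nonzero_cubesV/(nonzero_cubesM (nonzero_cubes_expr3 six_neq0)).
  rewrite (_ : 4 / 3 * 3 ^+ 3 = 6 ^+ 2); last by field.
  by rewrite exprS mulfK // expf_neq0.
have cV x : x \notin nonzero_cubes F -> x^-1 \notin nonzero_cubes F.
  by apply: contra => /nonzero_cubesV; rewrite invrK.
rewrite !inE => /or3P[] /eqP -> /or3P[] /eqP -> //=;
  rewrite ?divr1 ?div1r ?(negbTE c3) ?(negbTE c4) ?(negbTE c43)
          ?(negbTE (cV _ c3)) ?(negbTE (cV _ c4)) //.
by rewrite -invf_div (negbTE (cV _ c43)).
Qed.

(** * The factorisation of K_p by cube multiples of the three copies *)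

Lemma natr_dist (R : nzRingType) (a b : nat) :
  b%:R - a%:R = (-1) ^+ (b < a)%N * (dist (a, b))%:R :> R
  /\ (low (a, b))%:R = (if (b < a)%N then b%:R else a%:R) :> R.
Proof.
rewrite /dist /low /=; case: ltnP => ab.
  by rewrite (eqP (ltnW ab)) addn0 natrB 1?ltnW // mulN1r opprB.
by rewrite (eqP ab) add0n natrB // mul1r.
Qed.

Lemma natr_Fp_eq (p m n : nat) :
  prime p -> m%:R = n%:R :> 'F_p -> m = n %[mod p].
Proof. by move=> hp /(congr1 val); rewrite /= !val_Fp_nat. Qed.

(** The copies are the images of F under x -> u g_j(x), for u in [half_cubes] and three colours j.
    An arc determines first its length, by cosets of cubes, then u and its direction, then the
    colour. *)
Theorem OP_noncube_prime (p : nat) (V : finType) (F : sgraph V) :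
  noncube_primes p -> #|V| = p -> is_regular 2 F -> girth_at_least 6 F ->
  OP_solvable F.
Proof.
case=> hp p6 c2 c3 c6 hV F2 F6.
have p_gt8 : (8 < p)%N.
  (* Modulo 7, 6 = -1 is a cube. *)
  have p_neq7 : p != 7.
    apply: contraNneq c6 => p7; rewrite p7 /=; apply/unit_cubesP.
    by exists (-1); rewrite ?oppr_eq0 ?oner_neq0 //; apply/val_inj.
  by have := prime_gt1 hp; lia.
have natr_neq0 n : (0 < n <= 8)%N -> n%:R != 0 :> 'F_p.
  move=> hn; rewrite -(dvdn_pcharf (pchar_Fp hp)) gtnNdvd //; lia.
have two_neq0 : 2 != 0 :> 'F_p by exact: natr_neq0.
have three_neq0 : 3 != 0 :> 'F_p by exact: natr_neq0.
have cubesE a : (a \in unit_cubes p) = (a \in nonzero_cubes 'F_p).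
  apply/unit_cubesP/imsetP => [[c c0 ->]|[c + ->]]; first by exists c; rewrite ?inE.
  by rewrite inE; exists c.
rewrite !cubesE in c2 c3 c6.
have oddV : odd #|V| by rewrite hV; lia.
have [g [g_inj g_dist g_col]] := colour_maps F2 F6 oddV; rewrite hV in g_inj g_col.
pose U := {u : 'F_p | u \in half_cubes 'F_p}.
have U_neq0 (u : U) : val u != 0.
  have := valP u; rewrite inE => /andP[/imsetP[x]]; rewrite inE => x0 -> _.
  by rewrite expf_neq0.
have U_cube (u : U) : val u \in nonzero_cubes 'F_p.
  by have := valP u; rewrite inE => /andP[].
have colourP (j : 'I_3) : (j : nat) \in colours by case: j => [[|[|[|]]]].
have eF : #|'F_p| = #|V| by rewrite card_Fp.
pose phi (x : 'F_p) : 'I_#|V| := cast_ord eF (enum_rank x).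
have phi_inj : injective phi by move=> x y /cast_ord_inj/enum_rank_inj.
pose f (j : 'I_3) (x : V) : 'F_p := (g j x)%:R.
apply: (@OP_solvable_packing V (U * 'I_3)%type F (fun k x => phi (val k.1 * f k.2 x))).
- move=> [u j] x y /phi_inj/(mulfI (U_neq0 u))/(natr_Fp_eq hp); exact: g_inj.
- move=> [u j] [u' j'] x y x' y' xy xy' /phi_inj /= ex /phi_inj /= ey.
  have d1 := g_dist j x y (colourP j) xy.
  have d2 := g_dist j' x' y' (colourP j') xy'.
  have [e1 l1] := natr_dist 'F_p (g j x) (g j y).
  have [e2 l2] := natr_dist 'F_p (g j' x') (g j' y').
  have ed : val u * ((-1) ^+ (g j y < g j x)%N * (dist (g j x, g j y))%:R) =
      val u' * ((-1) ^+ (g j' y' < g j' x')%N * (dist (g j' x', g j' y'))%:R).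
    by rewrite -e1 -e2 !mulrBr; congr (_ - _).
  have s_cube (b : bool) : (-1) ^+ b \in nonzero_cubes 'F_p.
    apply/imsetP; exists ((-1) ^+ b); last by case: b; ring.
    by rewrite inE signr_eq0.
  set d := dist (g j x, g j y) in d1 e1 ed.
  set d' := dist (g j' x', g j' y') in d2 e2 ed.
  have diff_neq0 n : n \in diffs -> n%:R != 0 :> 'F_p.
    by rewrite !inE => /or3P[] /eqP ->; apply: natr_neq0.
  have dd : d = d'.
    apply: (diffs_quotient_noncube c2 c3 c6) => //.
    (* The equation +-u d = +-u' d' makes d / d' a product of cubes. *)
    have -> : d%:R / d'%:R = (-1) ^+ (g j y < g j x)%N *
        (-1) ^+ (g j' y' < g j' x')%N * (val u' / val u) :> 'F_p.
      apply: (mulIf (diff_neq0 d' d2)); rewrite divfK ?diff_neq0 //.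
      have u0 := U_neq0 u; have := signrMK (g j y < g j x)%N (d%:R : 'F_p).
      move: ed; set a := (-1) ^+ (g j y < g j x)%N; set b := (-1) ^+ _ => ed aad.
      transitivity (a * (val u * (a * d%:R)) / val u); last by rewrite ed; field.
      by rewrite -[LHS]aad; field.
    by rewrite !nonzero_cubesM ?s_cube ?nonzero_cubesV ?U_cube.
  move: ed; rewrite -dd !mulrA => /(mulIf (diff_neq0 d d1)) eu.
  (* Opposite signs would give u = -u', impossible within [half_cubes]. Equal signs make the lower
     ends of the two arcs correspond. *)
  have [eu' es] : val u = val u' /\ (g j y < g j x)%N = (g j' y' < g j' x')%N.
    have := half_cubes_opp (valP u) (valP u'); have := half_cubes_opp (valP u') (valP u).
    move: eu; do 2!case: (_ < _)%N; rewrite ?mulr1 ?mulrN1; try by move=> /oppr_inj ->.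
    - by move=> <-; rewrite eqxx.
    - by move=> -> _; rewrite eqxx.
    - by move=> ->.
  have {}eu' : u = u' by apply: val_inj.
  rewrite -eu' in ex ey *; congr pair; apply: val_inj.
  move/(mulfI (U_neq0 u)): ex => ex; move/(mulfI (U_neq0 u)): ey => ey.
  apply: (g_col j j' x y x' y') => //; apply: natr_Fp_eq => //.
  by rewrite l1 l2 es; case: ifP.
(* At least (p - 1) / 6 multipliers, 3 colours and 2 p arcs per copy give p (p - 1) arcs. *)
rewrite (card_arcs F2) card_prod card_sig card_ord.
have := card_half_cubes two_neq0; rewrite eF.
move: #|V| #|half_cubes _| => n m; nia.
Qed.

Local Close Scope ring_scope.

Theorem theorem28 :
  infinite_set noncube_primes /\
  (forall p : nat, noncube_primes p ->
   forall (V : finType) (F : sgraph V),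
     #|V| = p -> is_regular 2 F -> girth_at_least 6 F -> OP_solvable F).
Proof.
split; first exact: infinite_noncube_primes.
by move=> p hp V F; exact: OP_noncube_prime.
Qed.
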